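(* Let $\Omega\subset\mathbb{R}^d$, $k\in\mathbb{N}$, $p(\nabla),P,V$ and the sets $M(C_*,C^*,C_B,C_Q)$ be as in the context. Suppose that $0<C_*\le C^*$, $0\le C_B,C_Q$, $\{(a_m,b_m,q_m):m\in\mathbb{N}\}\subset M(C_*,C^*,C_B,C_Q)$, and $(a,b,q)\in M(C_*,C^*,C_B,C_Q)$. Suppose further that (i) $a_m\to a$ in measure, (ii) $b_m\to b$ in measure, (iii) for each $t>0$, $\int_0^t|q_m-q|\to 0$ in measure (as functions on $\Omega$). Let $f\in H^1_{\rm loc}(\mathbb{R},L^2(\Omega)^k)$ be causal. Denote by $u_m$, respectively $u$, the unique causal solution in $C^1(\mathbb{R},L^2(\Omega)^k)\cap C^0(\mathbb{R},V)$ of $$a_m\frac{\partial u_m}{\partial t}+p(\nabla)u_m+b_mu_m+q_m*u_m=f,\qquad\text{respectively}\qquad a\frac{\partial u}{\partial t}+p(\nabla)u+bu+q*u=f .$$ Then for any $T\in\mathbb{R}_+$, $$\lim_{m\to\infty}\|u_m-u\|_{L^\infty([0,T],L^2(\Omega)^k)}=0 .$$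
   Context: All functions are real-valued; $\mathbb{R}_+=[0,\infty)$; $\Omega\subset\mathbb{R}^d$ is a domain with interior $\Omega^{\rm int}$. A function of $t$ is causal if it vanishes for $t<0$. $p(\nabla)u=\sum_{j=1}^d p_j\,\partial u/\partial x_j$ with constant symmetric matrices $p_j\in\mathbb{R}^{k\times k}$. It is viewed initially as a densely defined skew-symmetric operator on $L^2(\Omega)^k$ whose domain is a subset of $C^\infty(\Omega^{\rm int})^k$ containing $C_0^\infty(\Omega^{\rm int})^k$. It is assumed that $p(\nabla)$ extends to a skew-adjoint operator $P$ with dense domain $V\subset L^2(\Omega)^k$, and $V$ carries the graph norm of $P$ or an equivalent norm. For $u(\cdot,t)\in V$, $p(\nabla)u$ means $Pu$. $(q*u)(\mathbf{x},t)=\int q(\mathbf{x},t-s)u(\mathbf{x},s)\,ds$. The equations hold a.e. in $\Omega$ for each $t$. $M(C_*,C^*,C_B,C_Q)$ is the set of $(a,b,q)\in L^\infty(\Omega,\mathbb{R}^{k\times k}_{\rm symm})\times L^\infty(\Omega,\mathbb{R}^{k\times k})\times L^1(\mathbb{R}_+,L^\infty(\Omega,\mathbb{R}^{k\times k}_{\rm symm}))$ with $C_*I<a(\mathbf{x})<C^*I$ for all $\mathbf{x}\in\Omega$, $\|b\|_{L^\infty(\Omega,\mathbb{R}^{k\times k})}<C_B$, $\|q\|_{L^1(\mathbb{R}_+,L^\infty(\Omega,\mathbb{R}^{k\times k}_{\rm symm}))}<C_Q$, and $q(t)=0$ for $t<0$. A sequence of measurable real-valued functions $g_m$ on $\Omega$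 converges to zero in measure iff for any $\epsilon>0$ the Lebesgue measure $|\{\mathbf{x}:|g_m(\mathbf{x})|>\epsilon\}|$ tends to $0$; $g_m\to g$ in measure means $g_m-g\to0$ in measure. Matrix-valued functions converge in measure if their components do. In (iii), $\int_0^t|q_m-q|$ denotes the function $\mathbf{x}\mapsto\int_0^t|q_m(\mathbf{x},s)-q(\mathbf{x},s)|\,ds$, with $|\cdot|$ a matrix norm. For each coefficient triple in $M(C_*,C^*,C_B,C_Q)$ and each causal $f\in H^1_{\rm loc}(\mathbb{R},L^2(\Omega)^k)$ the equation has a unique causal solution in $C^1(\mathbb{R},L^2(\Omega)^k)\cap C^0(\mathbb{R},V)$. *)

(* Defs.v *)
From HB Require Import structures.
From mathcomp Require Import all_boot all_order all_algebra.
From mathcomp Require Import all_classical all_reals all_analysis.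

Set Implicit Arguments.
Unset Strict Implicit.
Unset Printing Implicit Defensive.
Import Order.TTheory GRing.Theory Num.Theory.
Import numFieldNormedType.Exports.

Local Open Scope classical_set_scope.
Local Open Scope ring_scope.

(* The sigma-algebra on R^n generated by the coordinates, i.e. the Borel one. *)
Section measurable_rV.
Context {R : realType} (n : nat).

Let coord (i : 'I_n) (x : 'rV[R]_n) : R := x ord0 i.

Let rV_set0 : g_sigma_preimage coord set0.
Proof. exact: sigma_algebra0. Qed.

Let rV_setC A : g_sigma_preimage coord A -> g_sigma_preimage coord (~` A).
Proof. exact: sigma_algebraC. Qed.

Let rV_bigcup (F : (set 'rV[R]_n)^nat) :
  (forall i, g_sigma_preimage coord (F i)) ->
  g_sigma_preimage coord (\bigcup_i (F i)).
Proof. exact: sigma_algebra_bigcup. Qed.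

HB.instance Definition _ := @isMeasurable.Build default_measure_display
  'rV[R]_n (g_sigma_preimage coord) rV_set0 rV_setC rV_bigcup.

Lemma measurable_coord (i : 'I_n) :
  measurable_fun [set: 'rV[R]_n] (fun x : 'rV[R]_n => x ord0 i).
Proof.
move=> _ Y mY; rewrite setTI; apply: sub_sigma_algebra => /=.
rewrite -bigcup_seq/=; exists i => /=; first by rewrite mem_index_enum.
by exists Y => //; rewrite setTI.
Qed.

Lemma measurable_fun_rV d (T : measurableType d) (f : T -> 'rV[R]_n) :
  (forall i, measurable_fun [set: T] (fun x => f x ord0 i)) ->
  measurable_fun [set: T] f.
Proof.
move=> mf.
apply: (@measurability _ _ _ _ _ _
  (\big[setU/set0]_(i < n) preimage_set_system setT (coord i) measurable)) => //.
move=> _ [B + <-]; rewrite -bigcup_seq/= => -[i _ [C mC <-]].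
by rewrite setTI; exact: mf.
Qed.

End measurable_rV.

Section lebesgue_rV.
Context {R : realType}.

Definition rV_cons n (z : measurableTypeR R * 'rV[R]_n) : 'rV[R]_n.+1 :=
  @row_mx R 1 1 n (const_mx z.1) z.2.

Lemma measurable_rV_cons n : measurable_fun setT (@rV_cons n).
Proof.
apply: measurable_fun_rV => i; rewrite /rV_cons.
have [j ->|j ->] := @split_ordP 1 n i.
  under eq_fun do rewrite (@row_mxEl R 1 1 n) mxE.
  exact: measurable_fst.
under eq_fun do rewrite (@row_mxEr R 1 1 n).
apply: (@measurableT_comp _ _ _ _ _ _ (fun x : 'rV[R]_n => x ord0 j)) => //.
exact: measurable_coord.
Qed.

Section step.
Local Open Scope ereal_scope.
Variables (n : nat) (mu : {sigma_finite_measure set 'rV[R]_n -> \bar R}).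

Definition lebesgue_rV_step : set 'rV[R]_n.+1 -> \bar R :=
  pushforward (@lebesgue_measure R \x mu) (@rV_cons n).

Let step_preimage A : measurable A -> measurable (@rV_cons n @^-1` A).
Proof.
by move=> mA; rewrite -[X in measurable X]setTI; exact: measurable_rV_cons.
Qed.

Let step0 : lebesgue_rV_step set0 = 0.
Proof. by rewrite /lebesgue_rV_step /pushforward preimage_set0 measure0. Qed.

Let step_ge0 A : 0 <= lebesgue_rV_step A.
Proof. by rewrite /lebesgue_rV_step /pushforward; exact: measure_ge0. Qed.

Let step_sigma_additive : semi_sigma_additive lebesgue_rV_step.
Proof.
move=> F mF tF mUF; rewrite /lebesgue_rV_step /pushforward preimage_bigcup.
apply: measure_semi_sigma_additive.
- by move=> i; exact: step_preimage.
- apply/trivIsetP => i j _ _ ij; rewrite -preimage_setI.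
  by move/trivIsetP : tF => /(_ _ _ _ _ ij) ->//; rewrite preimage_set0.
- by rewrite -preimage_bigcup; exact: step_preimage.
Qed.

HB.instance Definition _ := isMeasure.Build _ _ _
  lebesgue_rV_step step0 step_ge0 step_sigma_additive.

Definition rV_uncons (x : 'rV[R]_n.+1) : measurableTypeR R * 'rV[R]_n :=
  (x ord0 ord0, @rsubmx R 1 1 n x).

Lemma rV_consK : cancel (@rV_cons n) rV_uncons.
Proof.
case=> a x; rewrite /rV_cons /rV_uncons /= row_mxKr; congr pair.
rewrite (_ : ord0 = lshift n (ord0 : 'I_1)); last exact: val_inj.
by rewrite (@row_mxEl R 1 1 n) mxE.
Qed.

Lemma measurable_rV_uncons : measurable_fun setT rV_uncons.
Proof.
apply/measurable_fun_pairP; split; first exact: measurable_coord.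
apply: measurable_fun_rV => i.
rewrite [X in measurable_fun _ X](_ : _ = fun x : 'rV[R]_n.+1 =>
  x ord0 (rshift 1 i)); first exact: measurable_coord.
by apply/funext => x /=; rewrite mxE.
Qed.

Let step_sigma_finite : sigma_finite setT lebesgue_rV_step.
Proof.
have /sigma_finiteP[F [FT ndF Foo]] := sigma_finiteT (@lebesgue_measure R).
have /sigma_finiteP[G [GT ndG Goo]] := sigma_finiteT mu.
exists (fun i => rV_uncons @^-1` (F i `*` G i)).
  rewrite -preimage_bigcup; apply/esym; rewrite -[RHS](preimage_setT rV_uncons).
  congr (_ @^-1` _); rewrite -setXTT FT GT predeqE => -[x y]; split.
    by move=> [i _ [] /= ? ?]; split; exists i.
  move=> [/= [i _ Fx] [j _ Gy]]; exists (maxn i j) => //; split.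
  - by move: x Fx; exact/subsetPset/ndF/leq_maxl.
  - by move: y Gy; exact/subsetPset/ndG/leq_maxr.
move=> i; have [mF Ffin] := Foo i; have [mG Gfin] := Goo i; split.
  rewrite -[X in measurable X]setTI; apply: measurable_rV_uncons => //.
  exact: measurableX.
rewrite /lebesgue_rV_step /pushforward -comp_preimage.
rewrite (_ : _ \o _ = id); last by apply/funext; exact: rV_consK.
by rewrite preimage_id product_measure1E// lte_mul_pinfty// ge0_fin_numE.
Qed.

HB.instance Definition _ := Measure_isSigmaFinite.Build _ _ _
  lebesgue_rV_step step_sigma_finite.

End step.

(* d-dimensional Lebesgue measure on the Borel sets of R^d, as the iterated
   product of the one-dimensional one. *)
Fixpoint lebesgue_rV (n : nat) : {sigma_finite_measure set 'rV[R]_n -> \bar R} :=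
  if n is m.+1 then lebesgue_rV_step (lebesgue_rV m)
  else \d_(0 : 'rV[R]_0).

Lemma lebesgue_rV_box (n : nat) (a b : 'I_n -> R) : (forall i, a i <= b i) ->
  lebesgue_rV n [set x | forall i, a i <= x ord0 i <= b i] =
  (\prod_(i < n) (b i - a i))%:E.
Proof.
elim: n a b => [|n ih] a b ab.
  rewrite /= big_ord0 diracE mem_set//=; by case.
rewrite /= /lebesgue_rV_step /pushforward.
rewrite (_ : _ @^-1` _ = `[a ord0, b ord0]%classic `*`
  [set x : 'rV[R]_n | forall i, a (lift ord0 i) <= x ord0 i <= b (lift ord0 i)]);
  last first.
  have E0 (z : R * 'rV[R]_n) : rV_cons z ord0 ord0 = z.1.
    rewrite /rV_cons (_ : ord0 = lshift n (ord0 : 'I_1)); last exact: val_inj.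
    by rewrite (@row_mxEl R 1 1 n) mxE.
  have E1 (z : R * 'rV[R]_n) i : rV_cons z ord0 (lift ord0 i) = z.2 ord0 i.
    rewrite /rV_cons (_ : lift ord0 i = rshift 1 i); last exact: val_inj.
    by rewrite (@row_mxEr R 1 1 n).
  apply/seteqP; split=> [z /= zab|z /= [z1 z2] i].
    split=> [|i /=]; first by have := zab ord0; rewrite E0 in_itv.
    by rewrite -E1.
  have [j ->|->] := unliftP ord0 i; first by rewrite E1.
  by rewrite E0; move: z1; rewrite in_itv.
rewrite product_measure1E//=; last first.
  rewrite (_ : [set _ | _] = \bigcap_(i in [set: 'I_n])
    ((fun x : 'rV[R]_n => x ord0 i) @^-1` `[a (lift ord0 i), b (lift ord0 i)])).
    apply: fin_bigcap_measurable => //= i _.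
    by rewrite -[X in measurable X]setTI; exact: measurable_coord.
  apply/seteqP; split=> [x /= h i _|x /= h i]; first by rewrite /= in_itv/=.
  by have := h i I; rewrite /= in_itv.
rewrite ih// lebesgue_measure_itv/= lte_fin big_ord_recl EFinM.
have := ab ord0; rewrite le_eqVlt => /predU1P[->|ab0].
  by rewrite ltxx subrr mul0e.
by rewrite ab0 EFinB.
Qed.
End lebesgue_rV.

(* Elements of L^2(Om)^k and L^oo(Om, R^(k x k)) are represented by functions on
   R^d of which only the values on Om matter, considered up to equality almost
   everywhere on Om. *)
Section function_spaces.
Context {R : realType} {d k : nat}.
Implicit Types (Om U : set 'rV[R]_d) (u v w : 'rV[R]_d -> 'cV[R]_k).
Implicit Types (A : 'rV[R]_d -> 'M[R]_k) (g : 'rV[R]_d -> R).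

(* Om need not be open: it may contain part of its boundary. *)
Definition is_domain Om :=
  [/\ measurable Om, connected Om & interior Om !=set0].

Definition dotv (x y : 'cV[R]_k) : R := \sum_(i < k) x i 0 * y i 0.

Definition L2fun Om u :=
  (forall i, measurable_fun Om (fun x => u x i 0)) /\
  (lebesgue_rV d).-integrable Om (fun x => (dotv (u x) (u x))%:E).

Definition L2dot Om u v : R := \int[lebesgue_rV d]_(x in Om) dotv (u x) (v x).

Definition L2norm Om u : R := Num.sqrt (L2dot Om u u).

Definition L2dense Om (S : set ('rV[R]_d -> 'cV[R]_k)) :=
  forall u, L2fun Om u -> forall e : R, 0 < e ->
  exists2 v, S v & L2norm Om (u \- v) < e.

Definition is_mxnorm (nrm : 'M[R]_k -> R) :=
  [/\ forall B C, nrm (B + C) <= nrm B + nrm C,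
      forall c B, nrm (c *: B) = `|c| * nrm B
    & forall B, nrm B = 0 -> B = 0].

(* [patch (cst 0)] extends by 0 outside Om, so that the essential supremum over
   R^d is the one over Om, and is 0 if Om is negligible. *)
Definition Linfnorm (nrm : 'M[R]_k -> R) Om A : \bar R :=
  ('N[lebesgue_rV d]_+oo[EFin \o patch (cst 0%R) Om (fun x => nrm (A x))])%E.

Definition Linffun (nrm : 'M[R]_k -> R) Om A :=
  (forall i j, measurable_fun Om (fun x => A x i j)) /\
  (Linfnorm nrm Om A < +oo)%E.

Definition cvg_in_measure Om (g_ : nat -> 'rV[R]_d -> R) g :=
  forall e : R, 0 < e ->
  lebesgue_rV d (Om `&` [set x | e < `|g_ m x - g x|]) @[m --> \oo] --> 0%E.

Definition cvg_in_measure_mx Om (A_ : nat -> 'rV[R]_d -> 'M[R]_k) A :=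
  forall i j, cvg_in_measure Om (fun m x => A_ m x i j) (fun x => A x i j).

Definition partial (j : 'I_d) u : 'rV[R]_d -> 'cV[R]_k :=
  'D_(delta_mx 0 j : 'rV[R]_d) u.

(* C^oo on the open set U: all iterated partial derivatives exist and are
   continuous there. *)
Definition smooth_on U u := forall (s : seq 'I_d) x, U x ->
  {for x, continuous (foldr partial u s)} /\
  forall j : 'I_d, derivable (foldr partial u s) x (delta_mx 0 j : 'rV[R]_d).

Definition test_field Om u := smooth_on setT u /\
  exists K, [/\ compact K, K `<=` interior Om & forall x, ~ K x -> u x = 0].

(* p(nabla) u, as a function on the interior of Om extended by 0. *)
Definition p_nabla (p : 'I_d -> 'M[R]_k) Om u : 'rV[R]_d -> 'cV[R]_k :=
  patch (cst 0) (interior Om) (fun x => \sum_(j < d) p j *m partial j u x).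

(* D is the initial domain of p(nabla) as a densely defined skew-symmetric
   operator on L^2(Om)^k. *)
Record skew_symmetric_on Om (p : 'I_d -> 'M[R]_k)
    (D : set ('rV[R]_d -> 'cV[R]_k)) : Prop := {
  test_in_dom : forall u, test_field Om u -> D u;
  dom_smooth : forall u, D u -> smooth_on (interior Om) u;
  dom_L2 : forall u, D u -> L2fun Om u /\ L2fun Om (p_nabla p Om u);
  dom_linear : forall (c : R) u v, D u -> D v -> D (fun x => c *: u x + v x);
  dom_dense : L2dense Om D;
  dom_skew : forall u v, D u -> D v ->
    L2dot Om (p_nabla p Om u) v = - L2dot Om u (p_nabla p Om v) }.

(* (v, w) belongs to the graph of the adjoint of the operator P with domain V. *)
Definition adjoint_graph Om (V : set ('rV[R]_d -> 'cV[R]_k))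
    (P : ('rV[R]_d -> 'cV[R]_k) -> 'rV[R]_d -> 'cV[R]_k) v w :=
  [/\ L2fun Om v, L2fun Om w & forall u, V u -> L2dot Om (P u) v = L2dot Om u w].

(* P, with domain V, is a linear operator on classes of functions modulo
   equality a.e. on Om, and its adjoint is -P. *)
Record skew_adjoint Om (V : set ('rV[R]_d -> 'cV[R]_k))
    (P : ('rV[R]_d -> 'cV[R]_k) -> 'rV[R]_d -> 'cV[R]_k) : Prop := {
  V_L2 : forall u, V u -> L2fun Om u /\ L2fun Om (P u);
  V_ae : forall u v, V u -> L2fun Om v -> ae_eq (lebesgue_rV d) Om u v ->
    V v /\ ae_eq (lebesgue_rV d) Om (P u) (P v);
  V_linear : forall (c : R) u v, V u -> V v ->
    V (fun x => c *: u x + v x) /\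
    ae_eq (lebesgue_rV d) Om (P (fun x => c *: u x + v x))
      (fun x => c *: P u x + P v x);
  V_dense : L2dense Om V;
  P_adjoint : forall v w, adjoint_graph Om V P v w <->
    [/\ V v, L2fun Om w & ae_eq (lebesgue_rV d) Om w (fun x => - P v x)] }.

Definition extends_p_nabla Om (p : 'I_d -> 'M[R]_k)
    (D V : set ('rV[R]_d -> 'cV[R]_k))
    (P : ('rV[R]_d -> 'cV[R]_k) -> 'rV[R]_d -> 'cV[R]_k) :=
  forall u, D u -> V u /\ ae_eq (lebesgue_rV d) Om (P u) (p_nabla p Om u).

Definition graph_norm Om (P : ('rV[R]_d -> 'cV[R]_k) -> 'rV[R]_d -> 'cV[R]_k) u :=
  Num.sqrt (L2norm Om u ^+ 2 + L2norm Om (P u) ^+ 2).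

(* nV is a norm on V equivalent to the graph norm of P. *)
Record is_V_norm Om (V : set ('rV[R]_d -> 'cV[R]_k))
    (P : ('rV[R]_d -> 'cV[R]_k) -> 'rV[R]_d -> 'cV[R]_k)
    (nV : ('rV[R]_d -> 'cV[R]_k) -> R) : Prop := {
  nV_triangle : forall u v, V u -> V v -> nV (u \+ v) <= nV u + nV v;
  nV_homog : forall (c : R) u, V u -> nV (fun x => c *: u x) = `|c| * nV u;
  nV_equiv : exists c1 c2 : R, [/\ 0 < c1, 0 < c2 & forall u, V u ->
    c1 * graph_norm Om P u <= nV u <= c2 * graph_norm Om P u] }.

End function_spaces.

(* A function of time with values in L^2(Om)^k or L^oo(Om, R^(k x k)) is
   represented by a function of (t, x), jointly measurable on R x Om. *)
Section evolution.
Context {R : realType} {d k : nat}.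
Implicit Types (Om : set 'rV[R]_d) (f g u : R -> 'rV[R]_d -> 'cV[R]_k).
Implicit Types (a b : 'rV[R]_d -> 'M[R]_k) (q : R -> 'rV[R]_d -> 'M[R]_k).

Definition jointly_measurable m n Om (w : R -> 'rV[R]_d -> 'M[R]_(m, n)) :=
  forall i j, measurable_fun (setT `*` Om)
    (fun z : measurableTypeR R * 'rV[R]_d => w z.1 z.2 i j).

Definition causal Om u :=
  forall t, t < 0 -> ae_eq (lebesgue_rV d) Om (u t) (cst 0).

Definition L2continuous Om u :=
  forall t, L2norm Om (u s \- u t) @[s --> t] --> 0.

Definition L2derivative Om u g := forall t,
  L2norm Om (fun x => h^-1 *: (u (t + h) x - u t x) - g t x) @[h --> 0^'] --> 0.

Definition L2loc Om f := jointly_measurable Om f /\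
  forall r : R, (lebesgue_measure \x lebesgue_rV d)%E.-integrable
    (`[- r, r]%classic `*` Om)
    (fun z : measurableTypeR R * 'rV[R]_d => (dotv (f z.1 z.2) (f z.1 z.2))%:E).

Definition test_function (phi : R -> R) :=
  (forall n t, derivable (derive1n n phi) t 1) /\
  exists r : R, forall t, r < `|t| -> phi t = 0.

(* The identity between Bochner integrals in L^2(Om)^k is written at almost
   every x, with Lebesgue integrals in t. *)
Definition weak_derivative Om f g := forall phi, test_function phi ->
  {ae lebesgue_rV d, forall x, Om x -> forall i,
    \int[lebesgue_measure]_t (derive1 phi t * f t x i 0) =
    - \int[lebesgue_measure]_t (phi t * g t x i 0)}.

(* H^1_loc(R, L^2(Om)^k); f is the continuous representative, which is the one
   the equation refers to when it is required to hold at each t. *)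
Definition H1loc Om f :=
  [/\ forall t, L2fun Om (f t), L2continuous Om f, L2loc Om f
    & exists2 g, L2loc Om g & weak_derivative Om f g].

(* Simple functions of t with values in L^oo(Om, R^(k x k)). *)
Definition simple_curve nrm Om q :=
  exists n (T : 'I_n -> set (measurableTypeR R)) (c : 'I_n -> 'rV[R]_d -> 'M[R]_k),
    (forall i, measurable (T i) /\ Linffun nrm Om (c i)) /\
    forall t x, q t x = \sum_(i < n) \1_(T i) t *: c i x.

Definition L1Linfnorm nrm Om q : \bar R :=
  (\int[lebesgue_measure]_(t in `[0%R, +oo[) Linfnorm nrm Om (q t))%E.

(* L^1(R_+, L^oo(Om, R^(k x k))), in the sense of Bochner. *)
Definition L1Linf nrm Om q :=
  [/\ jointly_measurable Om q,
      exists2 q_ : nat -> R -> 'rV[R]_d -> 'M[R]_k,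
        forall n, simple_curve nrm Om (q_ n) &
        {ae lebesgue_measure, forall t, 0 <= t ->
          Linfnorm nrm Om (q_ n t \- q t) @[n --> \oo] --> 0%E}
    & (L1Linfnorm nrm Om q < +oo)%E].

Definition posdef (A : 'M[R]_k) :=
  forall v : 'cV[R]_k, v != 0 -> 0 < (v^T *m A *m v) 0 0.

(* The set M(Clo, Cup, CB, CQ) for the matrix norm nrm; the bounds on a are in
   the sense of symmetric matrices. *)
Record coefs nrm Om (Clo Cup CB CQ : R) a b q : Prop := {
  a_Linf : Linffun nrm Om a;
  a_symm : forall x, Om x -> (a x)^T = a x;
  a_bounds : forall x, Om x -> posdef (a x - Clo%:M) /\ posdef (Cup%:M - a x);
  b_Linf : Linffun nrm Om b;
  b_bound : (Linfnorm nrm Om b < CB%:E)%E;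
  q_L1Linf : L1Linf nrm Om q;
  q_symm : forall t x, Om x -> (q t x)^T = q t x;
  q_bound : (L1Linfnorm nrm Om q < CQ%:E)%E;
  q_causal : forall t x, t < 0 -> Om x -> q t x = 0 }.

Definition conv q u : R -> 'rV[R]_d -> 'cV[R]_k := fun t x =>
  \col_i (\int[lebesgue_measure]_s (q (t - s) x *m u s x) i 0).

(* u is a causal solution of a du/dt + p(nabla) u + b u + q * u = f in
   C^1(R, L^2(Om)^k) and C^0(R, V). *)
Record causal_solution Om (V : set ('rV[R]_d -> 'cV[R]_k))
    (P : ('rV[R]_d -> 'cV[R]_k) -> 'rV[R]_d -> 'cV[R]_k)
    (nV : ('rV[R]_d -> 'cV[R]_k) -> R) a b q f u : Prop := {
  sol_measurable : jointly_measurable Om u;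
  sol_V : forall t, V (u t);
  sol_continuous : forall t, nV (u s \- u t) @[s --> t] --> 0;
  sol_causal : causal Om u;
  sol_equation : exists dtu : R -> 'rV[R]_d -> 'cV[R]_k,
    [/\ forall t, L2fun Om (dtu t),
        L2derivative Om u dtu,
        L2continuous Om dtu
      & forall t, {ae lebesgue_rV d, forall x, Om x ->
          a x *m dtu t x + P (u t) x + b x *m u t x + conv q u t x = f t x}] }.

(* The norm of L^oo([0, T], L^2(Om)^k). *)
Definition LinfL2norm Om (T : R) u : \bar R :=
  ('N[lebesgue_measure]_+oo[EFin \o patch (cst 0%R) `[0%R, T] (fun t => L2norm Om (u t))])%E.

End evolution.

(* Main.v *)
(** Subtracting the two equations, w = u_m - u solves the m-th equation with the
    source -(a_m - a) u' - (b_m - b) u - (q_m - q) * u.  Since P is skew-adjoint,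
    <P w, w> = 0, and the energy E = <a_m w, w> obeys
    E' <= K sup_(s <= t) |w(s)|^2 + delta_m with K independent of m.  No integral
    inequality is needed: at a maximum point of exp(-lambda t) E(t) on [0, T] the
    energy dominates all its earlier values, so for lambda large the memory term
    is absorbed and E = O(delta_m).

    That delta_m -> 0 follows by splitting Omega into a set B_m on which one of the
    coefficient differences exceeds e, and its complement.  The measure of B_m
    tends to 0, so the integral of |u(s)|^2 + |u'(s)|^2 over B_m tends to 0, and by
    compactness of [0, T] it does so uniformly in s.  The convolution is reduced
    to such integrals by Young's inequality and Tonelli's theorem:
    2 |y . (q * v)(t, x)| <= c Q(x) |y|^2 + I(t, x) / c, where Q is the time
    integral of |q| and the integral of I(t, .) over B is at most
    |q|_(L^1 L^oo) times the supremum over s <= t of the integral of |v(s)|^2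
    over B. *)

Require Import Defs.
From HB Require Import structures.
From mathcomp Require Import all_boot all_order all_algebra.
From mathcomp Require Import all_classical all_reals all_analysis.
From mathcomp Require Import measurable_realfun ess_sup_inf.
From mathcomp Require Import ring lra.

Set Implicit Arguments.
Unset Strict Implicit.
Unset Printing Implicit Defensive.
Import Order.TTheory GRing.Theory Num.Theory.
Import numFieldNormedType.Exports.

Local Open Scope classical_set_scope.
Local Open Scope ring_scope.

(** * Matrices acting on vectors *)

(** Convergence in measure leaves a difference such as [a_m - a] of order one on a small set, so it
    need not be small as an operator on $L^2$. The subtraction is therefore arranged so that the
    coefficient differences act on the fixed functions u and u', while the unknown w meets only
    coefficients of the m-th equation, which are bounded uniformly in m. Young's parameters follow
    this: w always receives a constant, and the size of the difference goes to u or u'. A bound on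
    u_m over [0, T] that depends on m is used as well, but only to make convolutions finite.

    The energy is never differentiated: one-sided increments, estimated through the difference
    quotient of w in $L^2$, are enough at a maximum point.

    Bounds on kernels and causality of solutions hold for almost every x at each fixed time, with an
    exceptional set depending on the time, whereas the convolution integrates over time at fixed x.
    Tonelli's theorem for null sets exchanges the two. *)

Section dot_product.
Context {R : realType} {k : nat}.
Implicit Types (u v w : 'cV[R]_k) (B C : 'M[R]_k).

(** The working norm: its measurability and Young's inequality can be treated entry by entry. The
    arbitrary norm [nrm] of the statement is compared with it through two constants. *)
Definition l1norm B : R := \sum_i \sum_j `|B i j|.

Lemma l1norm_ge0 B : 0 <= l1norm B.
Proof. by apply: sumr_ge0 => i _; apply: sumr_ge0. Qed.

Lemma l1normN B : l1norm (- B) = l1norm B.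
Proof. by apply: eq_bigr => i _; apply: eq_bigr => j _; rewrite mxE normrN. Qed.

Lemma l1normD B C : l1norm (B + C) <= l1norm B + l1norm C.
Proof.
rewrite -big_split ler_sum// => i _; rewrite -big_split ler_sum// => j _.
by rewrite mxE ler_normD.
Qed.

Lemma l1norm_le B (c : R) : (forall i j, `|B i j| <= c) ->
  l1norm B <= (k * k)%:R * c.
Proof.
move=> h; apply: (@le_trans _ _ (\sum_(i < k) \sum_(j < k) c)).
  by apply: ler_sum => i _; apply: ler_sum => j _.
by rewrite !sumr_const !card_ord -mulrnA mulr_natl.
Qed.

Lemma dotvC u v : dotv u v = dotv v u.
Proof. by apply: eq_bigr => i _; rewrite mulrC. Qed.

Lemma dotvDl u v w : dotv (u + v) w = dotv u w + dotv v w.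
Proof. by rewrite -big_split; apply: eq_bigr => i _; rewrite mxE mulrDl. Qed.

Lemma dotvDr u v w : dotv u (v + w) = dotv u v + dotv u w.
Proof. by rewrite dotvC dotvDl !(dotvC u). Qed.

Lemma dotvZl (c : R) u v : dotv (c *: u) v = c * dotv u v.
Proof. by rewrite mulr_sumr; apply: eq_bigr => i _; rewrite mxE mulrA. Qed.

Lemma dotvZr (c : R) u v : dotv u (c *: v) = c * dotv u v.
Proof. by rewrite dotvC dotvZl dotvC. Qed.

Lemma dotvNl u v : dotv (- u) v = - dotv u v.
Proof. by rewrite -scaleN1r dotvZl mulN1r. Qed.

Lemma dotvNr u v : dotv u (- v) = - dotv u v.
Proof. by rewrite dotvC dotvNl dotvC. Qed.

Lemma dotv0r u : dotv u 0 = 0.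
Proof. by rewrite -(scale0r 0) dotvZr mul0r. Qed.

Lemma dotv_ge0 u : 0 <= dotv u u.
Proof. by apply: sumr_ge0 => i _; rewrite -expr2 sqr_ge0. Qed.

Lemma dotv_eq0 u : dotv u u = 0 -> u = 0.
Proof.
move=> /eqP; rewrite psumr_eq0; last by move=> i _; rewrite -expr2 sqr_ge0.
move=> /allP u0; apply/colP => i; rewrite mxE.
by have := u0 i (mem_index_enum i); rewrite -expr2 sqrf_eq0 => /eqP.
Qed.

Lemma dotv_quad B u v : (u^T *m B *m v) 0 0 = dotv u (B *m v).
Proof. by rewrite -mulmxA !mxE; apply: eq_bigr => i _; rewrite mxE. Qed.

Lemma dotv_trmx B u v : dotv u (B *m v) = dotv (B^T *m u) v.
Proof.
rewrite -dotv_quad !mxE; apply: eq_bigr => i _; congr (_ * _).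
by rewrite !mxE; apply: eq_bigr => j _; rewrite !mxE mulrC.
Qed.

Lemma young (a b c : R) : 0 < c -> 2 * (`|a| * `|b|) <= c * a ^+ 2 + c^-1 * b ^+ 2.
Proof.
move=> c0; rewrite -(real_normK (num_real a)) -(real_normK (num_real b)).
rewrite -subr_ge0 [leRHS](_ : _ = c * (`|a| - c^-1 * `|b|) ^+ 2).
  by rewrite mulr_ge0 ?sqr_ge0// ltW.
by field; rewrite gt_eqF.
Qed.

(* Young's inequality for the entries [u i 0] and [v j 0], summed with the
   weights [|B i j|]. *)
Lemma dotv_mx_young B u v (c : R) : 0 < c ->
  2 * `|dotv u (B *m v)| <= l1norm B * (c * dotv u u + c^-1 * dotv v v).
Proof.
move=> c0.
have le_dot (w : 'cV[R]_k) i : w i 0 ^+ 2 <= dotv w w.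
  rewrite /dotv (bigD1 i)//= -expr2 lerDl; apply: sumr_ge0 => j _.
  by rewrite -expr2 sqr_ge0.
rewrite (_ : dotv u _ = \sum_i \sum_j (u i 0 * (B i j * v j 0))); last first.
  by apply: eq_bigr => i _; rewrite mxE mulr_sumr.
have le1 : `|\sum_i \sum_j (u i 0 * (B i j * v j 0))| <=
    \sum_i \sum_j (`|B i j| * (`|u i 0| * `|v j 0|)).
  apply: le_trans (ler_norm_sum _ _ _) _; apply: ler_sum => i _.
  apply: le_trans (ler_norm_sum _ _ _) _; apply: ler_sum => j _.
  by rewrite !normrM mulrCA.
apply: (le_trans (ler_wpM2l _ le1)) => //.
rewrite mulr_sumr mulr_suml; apply: ler_sum => i _.
rewrite mulr_sumr mulr_suml; apply: ler_sum => j _.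
rewrite mulrCA ler_wpM2l//; apply: (le_trans (young _ _ c0)).
by apply: lerD; rewrite ler_wpM2l ?le_dot// ?invr_ge0 ltW.
Qed.

Lemma dotv_young u v (c : R) : 0 < c ->
  2 * `|dotv u v| <= c * dotv u u + c^-1 * dotv v v.
Proof.
move=> c0; rewrite /dotv !mulr_sumr.
apply: (@le_trans _ _ (2 * \sum_(i < k) (`|u i 0| * `|v i 0|))).
  rewrite ler_wpM2l//; apply: le_trans (ler_norm_sum _ _ _) _.
  by apply: ler_sum => i _; rewrite normrM.
rewrite -big_split mulr_sumr; apply: ler_sum => i _ /=.
by rewrite -!expr2 young.
Qed.

(** The parameter [(l1norm B)^-1] in [dotv_mx_young] leaves the coefficient 1 for [u] and moves the
    whole size of [B] to [v]; later [u] is the unknown difference and [v] a fixed function. *)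
Lemma dotv_mx_le B u v :
  2 * `|dotv u (B *m v)| <= dotv u u + l1norm B ^+ 2 * dotv v v.
Proof.
have [B0|B0] := eqVneq (l1norm B) 0.
  have := dotv_mx_young B u v ltr01; rewrite B0 mul0r expr0n mul0r addr0.
  by move=> /le_trans; apply; exact: dotv_ge0.
have {}B0 : 0 < l1norm B by rewrite lt0r B0 l1norm_ge0.
have Bi : 0 < (l1norm B)^-1 by rewrite invr_gt0.
apply: (le_trans (dotv_mx_young B u v Bi)); rewrite mulrDr !mulrA.
by rewrite divff ?gt_eqF// mul1r invrK -expr2.
Qed.

Lemma dotvD_le u v : dotv (u + v) (u + v) <= 2 * dotv u u + 2 * dotv v v.
Proof.
rewrite !dotvDl !dotvDr (dotvC v u).
have := dotv_young u v ltr01; rewrite invr1 !mul1r.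
have := ler_norm (dotv u v); lra.
Qed.

Lemma posdef_ge0 B v : posdef B -> 0 <= dotv v (B *m v).
Proof.
move=> pB; have [->|v0] := eqVneq v 0; first by rewrite mulmx0 dotv0r.
by rewrite -dotv_quad ltW// pB.
Qed.

Lemma scalar_dotv (c : R) v : dotv v (c%:M *m v) = c * dotv v v.
Proof. by rewrite mul_scalar_mx dotvZr. Qed.

(* The forms [a] and [Cup - a] being positive, polarization at the basis
   vectors bounds the entries of [a]. *)
Lemma posdef_entry (Clo Cup : R) (a : 'M[R]_k) : 0 <= Clo -> a^T = a ->
  posdef (a - Clo%:M) -> posdef (Cup%:M - a) ->
  forall i j, `|a i j| <= Cup.
Proof.
move=> Clo0 sa lo up i j.
have nonneg v : 0 <= dotv v (a *m v) <= Cup * dotv v v.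
  apply/andP; split.
    have := posdef_ge0 v lo; rewrite mulmxBl dotvDr dotvNr scalar_dotv.
    by rewrite subr_ge0; apply: le_trans; rewrite mulr_ge0 ?dotv_ge0.
  have := posdef_ge0 v up; rewrite mulmxBl dotvDr dotvNr scalar_dotv.
  by rewrite subr_ge0.
pose e (l : 'I_k) : 'cV[R]_k := delta_mx l 0.
have ae m l : dotv (e m) (a *m e l) = a m l.
  rewrite /dotv (bigD1 m)//= big1 ?addr0 => [|n nm]; last first.
    by rewrite !mxE (negbTE nm) mul0r.
  rewrite !mxE !eqxx mul1r (bigD1 l)//= big1 ?addr0 => [|n nl].
    by rewrite mxE !eqxx mulr1.
  by rewrite mxE (negbTE nl) mulr0.
have ee l : dotv (e l) (e l) = 1.
  rewrite /dotv (bigD1 l)//= big1 ?addr0 => [|n nl].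
    by rewrite !mxE !eqxx mulr1.
  by rewrite !mxE (negbTE nl) mulr0.
have sym : a j i = a i j by rewrite -[in LHS]sa mxE.
have bd l : a l l <= Cup by have /andP[_] := nonneg (e l); rewrite ae ee mulr1.
have /andP[+ _] := nonneg (e i + e j).
have /andP[+ _] := nonneg (e i - e j).
rewrite !mulmxDr !mulmxN !dotvDl !dotvDr !dotvNl !dotvNr !ae sym.
by have := bd i; have := bd j; rewrite ler_norml => *; apply/andP; split; lra.
Qed.

End dot_product.

(** * Comparison of matrix norms *)

Section matrix_norm.
Context {R : realType} {k : nat} (nrm : 'M[R]_k -> R).
Hypothesis nrmP : is_mxnorm nrm.

Lemma mxnorm0 : nrm 0 = 0.
Proof. by case: nrmP => _ h _; rewrite -(scale0r 0) h normr0 mul0r. Qed.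

Lemma mxnormN B : nrm (- B) = nrm B.
Proof. by case: nrmP => _ h _; rewrite -scaleN1r h normrN1 mul1r. Qed.

Lemma mxnorm_ge0 B : 0 <= nrm B.
Proof.
case: nrmP => h _ _; have := h B (- B); rewrite subrr mxnorm0 mxnormN.
by rewrite -mulr2n pmulrn_lge0.
Qed.

Lemma mxnorm_le_l1 : exists2 K : R, 0 < K & forall B, nrm B <= K * l1norm B.
Proof.
case: nrmP => hD hZ _.
(* The summand 1 makes [K] positive also for [k = 0]. *)
pose K := 1 + \sum_i \sum_j nrm (delta_mx i j).
have K1 i j : nrm (delta_mx i j) <= K.
  apply: (@le_trans _ _ (\sum_j nrm (delta_mx i j))).
    by rewrite (bigD1 j)//= lerDl; apply: sumr_ge0 => *; exact: mxnorm_ge0.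
  rewrite /K [in leRHS](bigD1 i)//=; set r := \sum_(l | l != i) _.
  have : 0 <= r by apply: sumr_ge0 => l _; apply: sumr_ge0 => *; exact: mxnorm_ge0.
  lra.
have hsum (I : finType) (F : I -> 'M[R]_k) : nrm (\sum_i F i) <= \sum_i nrm (F i).
  elim/big_ind2 : _ => [|B b C c Bb Cc|//]; first by rewrite mxnorm0.
  by apply: le_trans (hD _ _) _; exact: lerD.
exists K => [|B].
  rewrite ltr_pwDl//; apply: sumr_ge0 => i _; apply: sumr_ge0 => j _.
  exact: mxnorm_ge0.
rewrite {1}(matrix_sum_delta B); apply: le_trans (hsum _ _) _.
rewrite mulr_sumr; apply: ler_sum => i _.
apply: le_trans (hsum _ _) _; rewrite mulr_sumr; apply: ler_sum => j _.
by rewrite hZ mulrC ler_wpM2r.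
Qed.

Lemma mx_entry_le m n (A : 'M[R]_(m, n)) i j : `|A i j| <= `|A|.
Proof.
by rewrite [leRHS]/Num.norm/= mx_normrE; apply/bigmax_geP; right; exists (i, j).
Qed.

(* The minimum of [nrm] on the unit sphere of the sup norm is positive. *)
Lemma l1_le_mxnorm : exists2 K : R, 0 < K & forall B, l1norm B <= K * nrm B.
Proof.
case: nrmP => hD hZ h0; have [K K0 hK] := mxnorm_le_l1.
(* Matrices are flattened to row vectors in order to apply the extreme value theorem there. *)
pose g (v : 'rV[R]_(k * k)) := nrm (vec_mx v).
have l1_sup (v : 'rV[R]_(k * k)) : l1norm (vec_mx v) <= (k * k)%:R * `|v|.
  by apply: l1norm_le => i j; rewrite mxE mx_entry_le.
have g_lip u v : `|g u - g v| <= K * ((k * k)%:R * `|u - v|).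
  apply: (@le_trans _ _ (nrm (vec_mx (u - v)))); last first.
    by apply: le_trans (hK _) _; rewrite ler_wpM2l// ltW.
  rewrite linearB/= ler_norml lerBlDr lerNl opprB lerBlDr -mxnormN opprB.
  have := hD (vec_mx u - vec_mx v) (vec_mx v).
  have := hD (vec_mx v - vec_mx u) (vec_mx u).
  by rewrite !subrK -(mxnormN (_ - vec_mx u)) opprB -/(g _) -/(g _) => -> ->.
have gc : continuous g.
  move=> v; apply/(@cvgrPdist_lt _ _ _ _ (nbhs_filter v)) => e e0.
  pose c := K * (k * k)%:R + 1.
  have c0 : 0 < c by rewrite ltr_wpDl// mulr_ge0// ltW.
  near=> u; apply: le_lt_trans (g_lip _ _) _; rewrite mulrA.
  apply: (@le_lt_trans _ _ (c * `|v - u|)).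
    by rewrite ler_wpM2r// lerDl.
  rewrite -ltr_pdivlMl// mulrC; near: u.
  by rewrite -filter_from_norm_nbhs; exists (e / c) => //=; rewrite divr_gt0.
pose S : set 'rV[R]_(k * k) := [set v | `|v| = 1].
have cS : compact S.
  apply: bounded_closed_compact.
    by exists 1; split => // x x1 v /= ->; rewrite ltW.
  rewrite (_ : S = Num.norm @^-1` [set 1]) //.
  by apply: closed_comp => [v _|]; [exact: norm_continuous|exact: closed_eq].
have key (c : R) : 0 < c -> (forall v, S v -> c <= g v) ->
    exists2 K : R, 0 < K & forall B, l1norm B <= K * nrm B.
  move=> c0 hc; exists ((k * k)%:R / c + 1) => [|B].
    by rewrite ltr_wpDl// divr_ge0// ltW.
  have [v0|v0] := eqVneq (mxvec B) 0.
    rewrite -(mxvecK B) v0 linear0 mxnorm0 mulr0.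
    have := l1_sup 0; rewrite normr0 mulr0; apply: le_trans.
    by rewrite linear0.
  have Sv : S (`|mxvec B|^-1 *: mxvec B).
    by rewrite /S/= normrZ normfV normr_id mulVf// normr_eq0.
  have := hc _ Sv; rewrite /g linearZ/= mxvecK hZ normfV normr_id.
  rewrite ler_pdivlMl ?normr_gt0// => cB.
  have := l1_sup (mxvec B); rewrite mxvecK => /le_trans; apply.
  rewrite mulrDl mul1r; apply: ler_wpDr; first exact: mxnorm_ge0.
  by rewrite -mulrA ler_wpM2l// ler_pdivlMl// mulrC.
(* For [k = 0] the unit sphere is empty, and [key] applies with any constant. *)
have [[v0 Sv0]|noS] := pselect (S !=set0); last first.
  by apply: (key 1) => // v Sv; exfalso; apply: noS; exists v.
have [c cS' hc] : exists2 c, c \in S & forall t, t \in S -> g c <= g t.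
  apply: EVT_min_rV => //; first by exists v0.
  exact: continuous_subspaceT.
apply: (key (g c)) => [|v Sv]; last by apply: hc; rewrite inE.
rewrite lt0r mxnorm_ge0 andbT; apply/negP => /eqP /h0 vc0.
have c0 : c = 0 by rewrite -(vec_mxK c) vc0 linear0.
by move: cS'; rewrite inE /S/= c0 normr0 => /esym/eqP; rewrite oner_eq0.
Unshelve. all: by end_near. Qed.

(* [nrm] is Lipschitz for [l1norm], hence the infimum over the rational matrices
   [Q] of [nrm Q + K * l1norm (A - Q)]. *)
Lemma measurable_mxnorm d (X : measurableType d) (A : X -> 'M[R]_k) (D : set X) :
  measurable D -> (forall i j, measurable_fun D (fun x => A x i j)) ->
  measurable_fun D (fun x => nrm (A x)).
Proof.
move=> mD mA; have [K K0 hK] := mxnorm_le_l1; case: nrmP => hD _ _.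
pose Qm (Q : 'M[rat]_k) : 'M[R]_k := map_mx ratr Q.
pose h Q x := nrm (Qm Q) + K * l1norm (A x - Qm Q).
have mh Q : measurable_fun D (h Q).
  apply: measurable_funD; first exact: measurable_cst.
  apply: measurable_funM; first exact: measurable_cst.
  apply: measurable_sum => i; apply: measurable_sum => j.
  apply: measurableT_comp => //.
  under eq_fun do rewrite !mxE.
  by apply: measurable_funB.
suff nrmE (r : R) : D `&` [set x | nrm (A x) < r] =
    \bigcup_n (if unpickle n is Some Q then D `&` [set x | h Q x < r] else set0).
  apply: (measurability _ (RGenInftyO.measurableE R)).
  move=> _ [_ [r ->] <-]; rewrite (_ : _ @^-1` _ = [set x | nrm (A x) < r]).
    rewrite nrmE; apply: bigcupT_measurable => n.
    case: unpickle => [Q|]; last exact: measurable0.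
    rewrite (_ : [set x | _] = h Q @^-1` `]-oo, r[).
      by apply: mh => //; exact: measurable_itv.
    by apply/seteqP; split => x /=; rewrite in_itv.
  by apply/seteqP; split => x /=; rewrite in_itv.
apply/seteqP; split => [x [Dx /= Ar]|x [n _]]; last first.
  case: unpickle => // Q [Dx /= hr]; split => //=; apply: le_lt_trans hr.
  rewrite -{1}(subrK (Qm Q) (A x)) addrC; apply: le_trans (hD _ _) _.
  by rewrite lerD2l hK.
(* The error [K * l1norm (A x - Q)] enters twice, once in [h] and once in the bound on the norm of
   [Q], hence the 2; the successor of [k * k] makes the last inequality strict. *)
pose e := (r - nrm (A x)) / (2 * K * (k * k).+1%:R).
have K2 : 0 < 2 * K * (k * k).+1%:R by rewrite !mulr_gt0.
have e0 : 0 < e by rewrite divr_gt0 ?subr_gt0.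
have /choice[Q hQ] : forall ij : 'I_k * 'I_k, exists q : rat,
    `|A x ij.1 ij.2 - ratr q| <= e.
  move=> [i j] /=; have /rat_in_itvoo[q] : A x i j < A x i j + e by rewrite ltrDl.
  rewrite in_itv/= => /andP[q1 q2]; exists q.
  by rewrite distrC ler_norml; apply/andP; split; lra.
pose QQ : 'M[rat]_k := \matrix_(i, j) Q (i, j).
exists (pickle QQ) => //; rewrite pickleK; split => //=.
have lQ : l1norm (A x - Qm QQ) <= (k * k)%:R * e.
  by apply: l1norm_le => i j; rewrite !mxE; exact: (hQ (i, j)).
have nQ : nrm (Qm QQ) <= nrm (A x) + K * l1norm (A x - Qm QQ).
  rewrite -{1}(subrK (A x) (Qm QQ)) addrC; apply: le_trans (hD _ _) _.
  by rewrite lerD2l -opprB mxnormN hK.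
have eE : e * (2 * K * (k * k).+1%:R) = r - nrm (A x).
  by rewrite mulfVK// gt_eqF.
have : e * (2 * K * (k * k)%:R) < e * (2 * K * (k * k).+1%:R).
  by rewrite ltr_pM2l// ltr_pM2l ?mulr_gt0// ltr_nat.
have := ler_wpM2l (ltW K0) lQ; rewrite eE /h; lra.
Qed.

End matrix_norm.

(** * Tonelli's theorem and convolution kernels *)

Section tonelli.
Local Open Scope ereal_scope.
Context d1 d2 (T1 : measurableType d1) (T2 : measurableType d2) (R : realType).
Variable m1 : {sigma_finite_measure set T1 -> \bar R}.
Variable m2 : {sigma_finite_measure set T2 -> \bar R}.

Section on_rectangle.
Variables (A : set T1) (B : set T2) (f : T1 * T2 -> \bar R).
Hypotheses (mA : measurable A) (mB : measurable B).
Hypothesis mf : measurable_fun (A `*` B) f.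
Hypothesis f0 : forall z, 0 <= f z.

Let mg : measurable_fun setT (f \_ (A `*` B)).
Proof. by apply/(measurable_restrictT _ _).1 => //; exact: measurableX. Qed.

Let g0 z : 0 <= (f \_ (A `*` B)) z.
Proof. by rewrite patchE; case: ifPn. Qed.

Let gE x y : (f \_ (A `*` B)) (x, y) =
  if x \in A then if y \in B then f (x, y) else 0 else 0.
Proof.
rewrite patchE; have -> : ((x, y) \in A `*` B) = (x \in A) && (y \in B).
  by apply/idP/andP => [|[]]; rewrite !inE.
by case: (x \in A) => //; case: (y \in B).
Qed.

Let sec2 y : \int[m1]_x (f \_ (A `*` B)) (x, y) =
  ((fun y => \int[m1]_(x in A) f (x, y)) \_ B) y.
Proof.
rewrite [RHS]patchE; case: ifPn => yB.
  rewrite [RHS]integral_mkcond; apply: eq_integral => x _.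
  by rewrite gE yB patchE.
by rewrite integral0_eq// => x _; rewrite gE (negbTE yB); case: ifP.
Qed.

Let sec1 x : \int[m2]_y (f \_ (A `*` B)) (x, y) =
  ((fun x => \int[m2]_(y in B) f (x, y)) \_ A) x.
Proof.
rewrite [RHS]patchE; case: ifPn => xA.
  rewrite [RHS]integral_mkcond; apply: eq_integral => y _.
  by rewrite gE xA patchE.
by rewrite integral0_eq// => y _; rewrite gE (negbTE xA).
Qed.

Lemma measurable_tonelli1 : measurable_fun A (fun x => \int[m2]_(y in B) f (x, y)).
Proof.
apply/(measurable_restrictT _ _).2 => //.
rewrite (_ : _ \_ A = fun x => \int[m2]_y (f \_ (A `*` B)) (x, y)).
  exact: (measurable_fun_fubini_tonelli_F (f \_ (A `*` B))).
by apply/funext => x; rewrite sec1.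
Qed.

Lemma measurable_tonelli2 : measurable_fun B (fun y => \int[m1]_(x in A) f (x, y)).
Proof.
apply/(measurable_restrictT _ _).2 => //.
rewrite (_ : _ \_ B = fun y => \int[m1]_x (f \_ (A `*` B)) (x, y)).
  exact: (measurable_fun_fubini_tonelli_G (f \_ (A `*` B))).
by apply/funext => x; rewrite sec2.
Qed.

Lemma tonelli_in : \int[m1]_(x in A) \int[m2]_(y in B) f (x, y) =
  \int[m2]_(y in B) \int[m1]_(x in A) f (x, y).
Proof.
rewrite integral_mkcond [RHS]integral_mkcond.
rewrite (eq_integral (fun x => \int[m2]_y (f \_ (A `*` B)) (x, y))); last first.
  by move=> x _; rewrite sec1.
rewrite [RHS](eq_integral (fun y => \int[m1]_x (f \_ (A `*` B)) (x, y))).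
  exact: (fubini_tonelli (f \_ (A `*` B))).
by move=> y _; rewrite sec2.
Qed.

End on_rectangle.

(** By Tonelli's theorem [N] is null for the product measure, so almost all of its other sections
    are null. This turns a property valid at each time for almost every point into one valid at
    almost every point for almost every time. *)
Lemma negligible_sections (N : set (T1 * T2)) : measurable N ->
  (forall x, {ae m2, forall y, ~ N (x, y)}) ->
  {ae m2, forall y, {ae m1, forall x, ~ N (x, y)}}.
Proof.
move=> mN aeN.
have m2N x : m2 (xsection N x) = 0.
  apply/negligibleP; first exact: measurable_xsection.
  by apply: negligibleS (aeN x) => y /=; rewrite /xsection/= inE => ? /(_ _).
pose f := (EFin \o \1_N : T1 * T2 -> \bar R).
have mf : measurable_fun setT f by apply/measurable_EFinP/measurable_indic.
have f0 z : 0 <= f z by rewrite lee_fin.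
have : \int[m2]_y `|\int[m1]_x f (x, y)| = 0.
  rewrite (eq_integral (fun y => \int[m1]_x f (x, y))); last first.
    by move=> y _; rewrite gee0_abs// integral_ge0.
  rewrite -fubini_tonelli// integral0_eq// => x _.
  have := indic_fubini_tonelli_FE m2 mN; rewrite /fubini_F => /(congr1 (@^~ x)) /=.
  by rewrite m2N.
move=> /(ae_eq_integral_abs _ measurableT) /=.
move=> /(_ (measurable_fun_fubini_tonelli_G f mf f0)).
apply: filterS => y /(_ I) /= y0.
have := indic_fubini_tonelli_GE m1 mN; rewrite /fubini_G => /(congr1 (@^~ y)) /=.
rewrite -/(f) [X in X = _ -> _]y0 => /esym mN0.
exists (ysection N y); split => //; first exact: measurable_ysection.
by move=> x /= /contrapT; rewrite /ysection/= inE.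
Qed.

End tonelli.

Section reflection.
Local Open Scope ereal_scope.
Context {R : realType}.
Local Notation leb := (@lebesgue_measure R).

Lemma measurable_reflect (t : R) :
  measurable_fun setT (fun s : measurableTypeR R => (t - s)%R : measurableTypeR R).
Proof. exact: measurable_funB. Qed.

(** The image of Lebesgue measure under [s |-> t - s] gives half-open intervals their length, so it
    is Lebesgue measure by uniqueness; the rest is integration against an image measure. *)
Lemma ge0_integral_reflect (F : R -> \bar R) (t : R) :
  measurable_fun setT F -> (forall s, 0 <= F s) ->
  \int[leb]_s F (t - s)%R = \int[leb]_s F s.
Proof.
move=> mF F0; pose phi := fun s : measurableTypeR R => (t - s)%R : measurableTypeR R.
pose mphi := isMeasurableFun.Build _ _ _ _ phi (measurable_reflect t).
pose phi' : {mfun _ >-> _} := HB.pack phi mphi.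
transitivity (\int[pushforward leb phi']_s F s); last first.
  apply: eq_measure_integral => A mA _; apply/esym.
  apply: (@lebesgue_measure_unique _ (pushforward leb phi')) => // _ [[a b]] _ <-.
  have E : phi' @^-1` `]a, b]%classic = `[(t - b)%R, (t - a)%R[%classic.
    apply/seteqP; split => s; rewrite /phi'/= /phi !in_itv/= => /andP[? ?].
      by apply/andP; split; lra.
    by apply/andP; split; lra.
  transitivity (leb `[(t - b)%R, (t - a)%R[%classic); last by rewrite -E.
  rewrite !lebesgue_measure_itv/= !lte_fin ltrD2l ltrN2.
  by case: ifPn => // _; rewrite -!EFinB; congr EFin; ring.
by rewrite ge0_integral_pushforward// preimage_setT.
Qed.

End reflection.

Section kernel.
Local Open Scope ereal_scope.
Context d (X : measurableType d) (R : realType).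
Variable mu : {sigma_finite_measure set X -> \bar R}.
Local Notation leb := (@lebesgue_measure R).
Variables (Om : set X) (rho : measurableTypeR R * X -> \bar R) (G : R -> \bar R).
Hypotheses (mOm : measurable Om) (mrho : measurable_fun (setT `*` Om) rho).
Hypothesis rho0 : forall z, 0 <= rho z.
Hypotheses (mG : measurable_fun setT G) (G0 : forall s, 0 <= G s).
Hypothesis rhoG : forall s, {ae mu, forall x, Om x -> rho (s, x) <= G s}.

Let mG1 : measurable_fun setT (fun z : measurableTypeR R * X => G z.1).
Proof. by apply: (measurableT_comp mG); exact: measurable_fst. Qed.

Let mX : measurable (setT `*` Om : set (measurableTypeR R * X)).
Proof. exact: measurableX. Qed.

Lemma measurable_section2 (f : measurableTypeR R * X -> \bar R) x :
  measurable_fun (setT `*` Om) f -> Om x ->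
  measurable_fun setT (fun s : measurableTypeR R => f (s, x)).
Proof.
move=> mf Omx; by apply: (measurable_comp mX _ mf) => // _ [s _ <-].
Qed.

Lemma measurable_section1 (f : measurableTypeR R * X -> \bar R) s :
  measurable_fun (setT `*` Om) f -> measurable_fun Om (fun x => f (s, x)).
Proof.
move=> mf; apply: (measurable_comp mX _ mf) => //.
  by move=> _ [x Omx <-].
by apply: measurable_funTS; exact: pair1_measurable.
Qed.

(** The exceptional set in [rhoG] depends on [s]. Here [x] is fixed before [s], as is required to
    integrate the kernel in time. *)
Lemma ae_kernel_le :
  {ae mu, forall x, Om x -> {ae leb, forall s, rho (s, x) <= G s}}.
Proof.
pose N := (setT `*` Om) `&` [set z | G z.1 < rho z].
have mN : measurable N.
  apply: measurable_lte => //; exact: measurable_funS mG1.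
have : {ae mu, forall x, {ae leb, forall s, ~ N (s, x)}}.
  apply: negligible_sections => // s; apply: filterS (rhoG s) => x h [/= [_ Omx]].
  by rewrite ltNge h.
apply: filterS => x aes Omx.
apply: (@filterS _ _ (ae_filter_ringOfSetsType leb) _ _ _ aes) => s h.
by rewrite leNgt; apply/negP => lt; apply: h; split.
Qed.

Lemma ae_kernel_mass_le :
  {ae mu, forall x, Om x -> \int[leb]_s rho (s, x) <= \int[leb]_s G s}.
Proof.
apply: filterS ae_kernel_le => x h Omx; apply: ae_ge0_le_integral => //.
- exact: measurable_section2.
- by apply: filterS (h Omx) => s.
Qed.

Lemma reflect_measurable t :
  measurable_fun (setT `*` Om) (fun z : measurableTypeR R * X => rho ((t - z.1)%R, z.2)).
Proof.
apply: (measurable_comp mX _ mrho) => //.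
  by move=> _ [[s x] [_ Omx] <-].
apply: measurable_funTS; apply: measurable_fun_pair; last exact: measurable_snd.
by apply: (measurableT_comp (measurable_reflect t)); exact: measurable_fst.
Qed.

Lemma ae_conv_mass_le t :
  {ae mu, forall x, Om x ->
    \int[leb]_(s in `[0%R, t]) rho ((t - s)%R, x) <= \int[leb]_s G s}.
Proof.
apply: filterS ae_kernel_mass_le => x h Omx; apply: le_trans (h Omx).
rewrite -(ge0_integral_reflect t)//; last exact: measurable_section2.
apply: ge0_subset_integral => //.
exact: (measurable_section2 (reflect_measurable t)).
Qed.

(** The reflection maps [[0, t]] onto itself, and [t <= T]. The right side is free of [t], so that
    smallness at the single time [T] serves all earlier times. *)
Lemma conv_mass_le (t T : R) x : Om x -> (t <= T)%R ->
  \int[leb]_(s in `[0%R, t]) rho ((t - s)%R, x) <=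
  \int[leb]_(s in `[0%R, T]) rho (s, x).
Proof.
move=> Omx tT; rewrite integral_mkcond [leRHS]integral_mkcond.
have mr : measurable_fun setT ((fun s => rho (s, x)) \_ `[0%R, T]).
  apply/(measurable_restrictT _ _).1 => //.
  by apply: measurable_funTS; exact: measurable_section2.
have r0 s : 0 <= ((fun s => rho (s, x)) \_ `[0%R, T]) s.
  by rewrite patchE; case: ifP.
rewrite -[leRHS](ge0_integral_reflect t)//; apply: ge0_le_integral => //.
- by move=> s _; rewrite patchE; case: ifP.
- apply/(measurable_restrictT _ _).1 => //.
  apply: measurable_funTS; exact: (measurable_section2 (reflect_measurable t)).
- by apply: (measurableT_comp mr); exact: measurable_reflect.
move=> s _; rewrite !patchE; case: ifPn => [|_]; last by case: ifP.
rewrite !mem_setE !in_itv/= => /andP[s0 st].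
by rewrite ifT//; apply/andP; split; lra.
Qed.

Variable nu : measurableTypeR R * X -> \bar R.
Hypotheses (mnu : measurable_fun (setT `*` Om) nu) (nu0 : forall z, 0 <= nu z).

Lemma measurable_conv_integrand t : measurable_fun (setT `*` Om)
  (fun z : measurableTypeR R * X => rho ((t - z.1)%R, z.2) * nu z).
Proof. by apply: emeasurable_funM => //; exact: reflect_measurable. Qed.

Lemma measurable_conv t : measurable_fun Om
  (fun x => \int[leb]_(s in `[0%R, t]) (rho ((t - s)%R, x) * nu (s, x))).
Proof.
apply: (@measurable_tonelli2 _ _ _ _ _ leb _ _
  (fun z => rho ((t - z.1)%R, z.2) * nu z)) => //.
- by apply: measurable_funS (measurable_conv_integrand t) => //; exact: setSX.
- by move=> z; rewrite mule_ge0.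
Qed.

(** After the exchange of integrals [s] is fixed first, so [rhoG] applies at [t - s] with its own
    exceptional set. What remains is [M] times the integral of the reflected majorant. *)
Lemma integral_conv_le t (B : set X) (M : \bar R) :
  measurable B -> B `<=` Om -> 0 <= M ->
  (forall s, (0 <= s <= t)%R -> \int[mu]_(x in B) nu (s, x) <= M) ->
  \int[mu]_(x in B) \int[leb]_(s in `[0%R, t]) (rho ((t - s)%R, x) * nu (s, x))
  <= M * \int[leb]_s G s.
Proof.
move=> mB BOm M0 nuM.
have mBt : measurable_fun (`[0%R, t] `*` B)
    (fun z : measurableTypeR R * X => rho ((t - z.1)%R, z.2) * nu z).
  by apply: measurable_funS (measurable_conv_integrand t) => // -[s x] [/= _ /BOm].
have f0 z : 0 <= rho ((t - z.1)%R, z.2) * nu z by rewrite mule_ge0.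
have mI : measurable (`[0%R, t] : set (measurableTypeR R)) by exact: measurable_itv.
have mGt : measurable_fun setT (fun s : measurableTypeR R => G (t - s)%R).
  by apply: (measurableT_comp mG); exact: measurable_reflect.
rewrite -(tonelli_in leb mu mI mB mBt f0).
apply: (@le_trans _ _ (\int[leb]_(s in `[0%R, t]) (M * G (t - s)%R))).
  apply: ge0_le_integral => //=.
  - by move=> s _; apply: integral_ge0 => x _; rewrite mule_ge0.
  - exact: (measurable_tonelli1 mu mI mB mBt f0).
  - by apply: measurable_funeM; exact: measurable_funTS.
  move=> s; rewrite in_itv/= => s0t.
  apply: (@le_trans _ _ (\int[mu]_(x in B) (G (t - s)%R * nu (s, x)))).
    have mnus : measurable_fun B (fun x => nu (s, x)).
      by apply: measurable_funS (measurable_section1 s mnu).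
    apply: ae_ge0_le_integral => //.
    - by move=> x _; rewrite mule_ge0.
    - apply: emeasurable_funM => //.
      by apply: measurable_funS (measurable_section1 (t - s)%R mrho).
    - by move=> x _; rewrite mule_ge0.
    - exact: measurable_funeM.
    - by apply: filterS (rhoG (t - s)%R) => x h /BOm /h; exact: lee_wpmul2r.
  rewrite ge0_integralZl//; last by apply: measurable_funS (measurable_section1 s mnu).
  by rewrite muleC lee_wpmul2r ?nuM.
rewrite ge0_integralZl//; last exact: measurable_funTS.
rewrite lee_wpmul2l// -[leRHS](ge0_integral_reflect t)//.
exact: ge0_subset_integral.
Qed.

End kernel.

(** * Square integrable vector fields *)

Section real_integrable.
Context d (X : measurableType d) (R : realType) (mu : {measure set X -> \bar R}).
Variables (D : set X) (mD : measurable D).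
Implicit Types f g : X -> R.

Lemma integrable_addr f g : mu.-integrable D (EFin \o f) ->
  mu.-integrable D (EFin \o g) ->
  mu.-integrable D (EFin \o (fun x => f x + g x)).
Proof. exact: integrableD. Qed.

Lemma integrable_mulr (c : R) f : mu.-integrable D (EFin \o f) ->
  mu.-integrable D (EFin \o (fun x => c * f x)).
Proof. exact: integrableZl. Qed.

End real_integrable.

Section square_integrable.
Context {R : realType} {d k : nat} (Om : set 'rV[R]_d).
Hypothesis mOm : measurable Om.
Local Notation mu := (lebesgue_rV d).
Implicit Types (u v w : 'rV[R]_d -> 'cV[R]_k) (A : 'rV[R]_d -> 'M[R]_k).

Lemma measurable_dotv u v :
  (forall i, measurable_fun Om (fun x => u x i 0)) ->
  (forall i, measurable_fun Om (fun x => v x i 0)) ->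
  measurable_fun Om (fun x => dotv (u x) (v x)).
Proof.
by move=> mu' mv; apply: measurable_sum => i; exact: measurable_funM.
Qed.

Lemma measurable_mulmx A u :
  (forall i j, measurable_fun Om (fun x => A x i j)) ->
  (forall i, measurable_fun Om (fun x => u x i 0)) ->
  forall i, measurable_fun Om (fun x => (A x *m u x) i 0).
Proof.
move=> mA mu' i; under eq_fun do rewrite mxE.
by apply: measurable_sum => j; exact: measurable_funM.
Qed.

Lemma measurable_l1norm m' (X : measurableType m') (D : set X) (B : X -> 'M[R]_k) :
  (forall i j, measurable_fun D (fun x => B x i j)) ->
  measurable_fun D (fun x => l1norm (B x)).
Proof.
move=> mB; apply: measurable_sum => i; apply: measurable_sum => j.
exact: measurableT_comp.
Qed.

Lemma L2fun_lin (c : R) u v : L2fun Om u -> L2fun Om v ->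
  L2fun Om (fun x => c *: u x + v x).
Proof.
move=> [mu' iu] [mv iv].
have mw i : measurable_fun Om (fun x => (c *: u x + v x) i 0).
  under eq_fun do rewrite !mxE.
  by apply: measurable_funD => //; exact: measurable_funM.
split=> //; apply: (@le_integrable _ _ _ mu _ mOm _
    (fun x => ((2 * c ^+ 2)%:E * (dotv (u x) (u x))%:E +
               2%:E * (dotv (v x) (v x))%:E)%E)).
- by apply/measurable_EFinP; exact: measurable_dotv.
- move=> x _; rewrite -!EFinM -EFinD !abse_EFin lee_fin.
  rewrite ger0_norm ?dotv_ge0// (le_trans _ (ler_norm _))//.
  apply: le_trans (dotvD_le _ _) _.
  by rewrite dotvZl dotvZr mulrA mulrA -(mulrA 2) -expr2.
- by apply: integrableD => //; exact: integrableZl.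
Qed.

Lemma L2funB u v : L2fun Om u -> L2fun Om v -> L2fun Om (u \- v).
Proof.
move=> hu hv; rewrite (_ : u \- v = fun x => (-1) *: v x + u x).
  exact: L2fun_lin.
by apply/funext => x; rewrite scaleN1r addrC.
Qed.

Lemma L2funZ (c : R) u : L2fun Om u -> L2fun Om (fun x => c *: u x).
Proof.
move=> hu; rewrite (_ : (fun x => _) = fun x => (c - 1) *: u x + u x).
  exact: L2fun_lin.
by apply/funext => x; rewrite scalerBl scale1r subrK.
Qed.

Lemma integrable_dotv u v : L2fun Om u -> L2fun Om v ->
  mu.-integrable Om (EFin \o (fun x => dotv (u x) (v x))).
Proof.
move=> [mu' iu] [mv iv]; apply: (@le_integrable _ _ _ mu _ mOm _
    (fun x => ((dotv (u x) (u x))%:E + (dotv (v x) (v x))%:E)%E)).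
- by apply/measurable_EFinP; exact: measurable_dotv.
- move=> x _ /=; rewrite lee_fin (le_trans _ (ler_norm _))//.
  have := dotv_young (u x) (v x) ltr01; rewrite invr1 !mul1r.
  by have := normr_ge0 (dotv (u x) (v x)); lra.
- exact: integrableD.
Qed.

Lemma integrable_dotv_mx A (c : R) u v :
  (forall i j, measurable_fun Om (fun x => A x i j)) ->
  (forall x, Om x -> l1norm (A x) <= c) -> L2fun Om u -> L2fun Om v ->
  mu.-integrable Om (EFin \o (fun x => dotv (u x) (A x *m v x))).
Proof.
move=> mA Ac [mu' iu] [mv iv]; apply: (@le_integrable _ _ _ mu _ mOm _
    (fun x => (c%:E * ((dotv (u x) (u x))%:E + (dotv (v x) (v x))%:E))%E)).
- apply/measurable_EFinP; apply: measurable_dotv => //.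
  exact: measurable_mulmx.
- move=> x Omx /=; rewrite lee_fin (le_trans _ (ler_norm _))//.
  have := dotv_mx_young (A x) (u x) (v x) ltr01; rewrite invr1 !mul1r.
  have D0 : 0 <= dotv (u x) (u x) + dotv (v x) (v x) by rewrite addr_ge0 ?dotv_ge0.
  have := ler_wpM2r D0 (Ac _ Omx).
  by have := normr_ge0 (dotv (u x) (A x *m v x)); lra.
- by apply: integrableZl => //; exact: integrableD.
Qed.

Lemma L2dot_ge0 u : 0 <= L2dot Om u u.
Proof. by apply: Rintegral_ge0 => x _; exact: dotv_ge0. Qed.

Lemma L2norm_sqr u : L2norm Om u ^+ 2 = L2dot Om u u.
Proof. by rewrite sqr_sqrtr// L2dot_ge0. Qed.

Lemma L2dotE u : L2fun Om u ->
  (\int[mu]_(x in Om) (dotv (u x) (u x))%:E)%E = (L2dot Om u u)%:E.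
Proof.
by move=> hu; rewrite fineK//; apply: integrable_fin_num => //; exact: integrable_dotv.
Qed.

Lemma L2dotD_le u v : L2fun Om u -> L2fun Om v ->
  L2dot Om (u \+ v) (u \+ v) <= 2 * L2dot Om u u + 2 * L2dot Om v v.
Proof.
move=> hu hv; have hw : L2fun Om (u \+ v).
  rewrite (_ : _ \+ _ = fun x => 1 *: u x + v x); first exact: L2fun_lin.
  by apply/funext => x; rewrite scale1r.
have iu := integrable_dotv hu hu; have iv := integrable_dotv hv hv.
rewrite -!RintegralZl// -RintegralD//.
- apply: le_Rintegral => //; first exact: integrable_dotv.
    by apply: integrable_addr => //; exact: integrable_mulr.
  by move=> x _; exact: dotvD_le.
- exact: integrable_mulr.
- exact: integrable_mulr.
Qed.

Lemma L2dot_ae0 u : L2fun Om u -> ae_eq mu Om u (cst 0) -> L2dot Om u u = 0.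
Proof.
move=> hu u0; rewrite /L2dot /Rintegral (ae_eq_integral (cst 0%E))//.
- by rewrite integral0.
- by apply/measurable_EFinP; apply: measurable_dotv; case: hu.
- by apply: filterS u0 => x h /h /= ->; rewrite dotv0r.
Qed.

(** Continuity and derivatives are defined through norms, while the estimates concern squared norms;
    this is the passage between them. *)
Lemma L2norm_near0 (T : Type) (F : set_system T) {FF : Filter F}
    (u : T -> 'rV[R]_d -> 'cV[R]_k) : L2norm Om (u h) @[h --> F] --> 0 ->
  forall e : R, 0 < e -> \forall h \near F, L2dot Om (u h) (u h) < e.
Proof.
move=> /cvgrPdist_lt u0 e e0; have se : 0 < Num.sqrt e by rewrite sqrtr_gt0.
apply: filterS (u0 _ se) => h; rewrite sub0r normrN ger0_norm ?sqrtr_ge0//.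
by rewrite ltr_sqrt.
Qed.

Definition L2form A u v : R := \int[mu]_(x in Om) dotv (u x) (A x *m v x).

Section bounded_form.
Variables (a : 'rV[R]_d -> 'M[R]_k) (c : R).
Hypothesis ma : forall i j, measurable_fun Om (fun x => a x i j).
Hypothesis ac : forall x, Om x -> l1norm (a x) <= c.

Let ia u v := @integrable_dotv_mx a c u v ma ac.

Lemma L2form_young u v (l : R) : 0 < l -> L2fun Om u -> L2fun Om v ->
  2 * `|L2form a u v| <= c * (l * L2dot Om u u + l^-1 * L2dot Om v v).
Proof.
move=> l0 hu hv.
have iu := integrable_dotv hu hu; have iv := integrable_dotv hv hv.
have iuv := ia hu hv.
apply: (@le_trans _ _ (\int[mu]_(x in Om) (2 * `|dotv (u x) (a x *m v x)|))).
  rewrite RintegralZl//; last exact: integrable_norm.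
  by rewrite ler_wpM2l// le_normr_Rintegral.
have i1 : mu.-integrable Om (EFin \o (fun x => l * dotv (u x) (u x))).
  exact: integrable_mulr.
have i2 : mu.-integrable Om (EFin \o (fun x => l^-1 * dotv (v x) (v x))).
  exact: integrable_mulr.
have i3 : mu.-integrable Om
    (EFin \o (fun x => l * dotv (u x) (u x) + l^-1 * dotv (v x) (v x))).
  exact: integrable_addr.
rewrite -!RintegralZl// -RintegralD// -RintegralZl//.
apply: le_Rintegral => //.
- by apply: integrable_mulr => //; exact: integrable_norm.
- exact: integrable_mulr.
- move=> x Omx; apply: le_trans (dotv_mx_young _ _ _ l0) _.
  rewrite ler_wpM2r ?ac// addr_ge0// mulr_ge0 ?dotv_ge0// ?invr_ge0 ltW//.
Qed.

Lemma L2formDr u v w : L2fun Om u -> L2fun Om v -> L2fun Om w ->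
  L2form a u (v \+ w) = L2form a u v + L2form a u w.
Proof.
move=> hu hv hw; rewrite -RintegralD//; try exact: ia.
by apply: eq_Rintegral => x _; rewrite mulmxDr dotvDr.
Qed.

Lemma L2formZr (r : R) u v : L2fun Om u -> L2fun Om v ->
  L2form a u (fun x => r *: v x) = r * L2form a u v.
Proof.
move=> hu hv; rewrite -RintegralZl//; last exact: ia.
by apply: eq_Rintegral => x _; rewrite -scalemxAr dotvZr.
Qed.

Hypothesis sa : forall x, Om x -> (a x)^T = a x.

Lemma L2form_expand u v : L2fun Om u -> L2fun Om v ->
  L2form a u u = L2form a v v + L2form a (u \- v) (u \- v) + 2 * L2form a v (u \- v).
Proof.
move=> hu hv; have hw := L2funB hu hv.
have i1 := ia hv hv; have i2 := ia hw hw; have i3 := ia hv hw.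
rewrite -RintegralZl// -RintegralD// -RintegralD//.
- apply: eq_Rintegral => x /[!inE] Omx /=.
  rewrite !mulmxBr !dotvDr !dotvDl !dotvNr !dotvNl.
  by rewrite (dotv_trmx _ (u x) (v x)) sa// (dotvC _ (v x)); ring.
- exact: integrable_addr.
- exact: integrable_mulr.
Qed.

Lemma L2form_ge0 (l : R) u : L2fun Om u -> 0 <= l ->
  (forall x (y : 'cV[R]_k), Om x -> l * dotv y y <= dotv y (a x *m y)) ->
  l * L2dot Om u u <= L2form a u u.
Proof.
move=> hu l0 h; have i1 := integrable_dotv hu hu; have i2 := ia hu hu.
rewrite -RintegralZl//; apply: le_Rintegral => //; first exact: integrable_mulr.
by move=> x Omx; exact: h.
Qed.

End bounded_form.

End square_integrable.

(** * The energy estimate *)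

Section energy.
Context {R : realType} {d k : nat} (Om : set 'rV[R]_d).
Hypothesis mOm : measurable Om.
Variables (a : 'rV[R]_d -> 'M[R]_k) (c Clo : R).
Hypothesis ma : forall i j, measurable_fun Om (fun x => a x i j).
Hypothesis ac : forall x, Om x -> l1norm (a x) <= c.
Hypothesis sa : forall x, Om x -> (a x)^T = a x.
Hypothesis Clo0 : 0 < Clo.
Hypothesis aClo : forall x (y : 'cV[R]_k), Om x -> Clo * dotv y y <= dotv y (a x *m y).
Variables w dw : R -> 'rV[R]_d -> 'cV[R]_k.
Hypotheses (wL2 : forall t, L2fun Om (w t)) (dwL2 : forall t, L2fun Om (dw t)).
Hypothesis dwP : L2derivative Om w dw.

Let E t := L2form Om a (w t) (w t).

Let form_nonneg u : L2fun Om u -> 0 <= L2form Om a u u.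
Proof.
move=> hu; rewrite -(mul0r (L2dot Om u u)); apply: (L2form_ge0 mOm ma ac) => //.
by move=> x y Omx; apply: le_trans (aClo _ Omx); rewrite ler_wpM2r ?dotv_ge0// ltW.
Qed.

Lemma energy_lower t : Clo * L2dot Om (w t) (w t) <= E t.
Proof. by apply: (L2form_ge0 mOm ma ac) => //; exact: ltW. Qed.

Lemma near_left0 (P : R -> Prop) : (\forall h \near 0^', P h) ->
  forall e : R, 0 < e -> exists2 t, 0 < t < e & P (- t).
Proof.
rewrite near_withinE => /nbhs_ballP[r /= r0 rP] e e0.
pose t := Num.min r e / 2.
have m0 : 0 < Num.min r e by rewrite lt_min r0.
have tr : t < r by rewrite /t ltr_pdivrMr// (@le_lt_trans _ _ r)// ?ge_min ?lexx// ltr_pMr// ltr1n.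
have te : t < e by rewrite /t ltr_pdivrMr// (@le_lt_trans _ _ e)// ?ge_min ?lexx ?orbT// ltr_pMr// ltr1n.
have t0 : 0 < t by rewrite divr_gt0.
exists t; first by rewrite t0.
apply: rP => /=; last by rewrite oppr_eq0 gt_eqF.
by rewrite /ball/= sub0r opprK gtr0_norm.
Qed.

(** [exp(-x) <= 1 / (1 + x)], and [(1 + x) (1 - x / 2) = 1 + x (1 - x) / 2]. The lost factor 2 is
    the one in [l / 2] of [energy_left_increment]. *)
Lemma expRN_le (x : R) : 0 <= x <= 1 -> expR (- x) <= 1 - x / 2.
Proof.
move=> /andP[x0 x1]; rewrite expRN.
have e1 := expR_ge1Dx x; have x10 : 0 < 1 + x by lra.
apply: (@le_trans _ _ (1 + x)^-1); first by rewrite lef_pV2// posrE expR_gt0.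
rewrite -[leLHS]mul1r ler_pdivrMr//.
have : 0 <= x * (1 - x) by rewrite mulr_ge0// subr_ge0.
lra.
Qed.

(* Because [a] is positive, [E t - E (t - h)] is at most
   [2 * h * L2form a (w t) q], where [q] is the difference quotient. *)
Lemma energy_left_increment t (l e : R) : 0 < l -> 0 < e ->
  (forall h, 0 < h < e -> E (t - h) <= expR (- (l * h)) * E t) ->
  l / 2 * E t <= 2 * L2form Om a (w t) (dw t).
Proof.
move=> l0 e0 hE; apply/ler_addgt0Pr => eps eps0.
have Et0 : 0 <= E t by exact: form_nonneg.
(* [c] need not be positive, and the choices below divide by the bound. *)
pose c' := `|c| + 1; have c0 : 0 < c' by rewrite ltr_wpDl.
have ac' x : Om x -> l1norm (a x) <= c'.
  by move=> /ac /le_trans; apply; rewrite (le_trans (ler_norm _))// lerDl.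
pose N := L2dot Om (w t) (w t); have N0 : 0 <= N by exact: L2dot_ge0.
(* With this Young parameter and the threshold in [q0], the contributions of [w t] and of the error
   [g] of the difference quotient are each at most [eps / 2]. *)
pose m := eps / (2 * (c' * (N + 1))).
have N1 : 0 < N + 1 by rewrite ltr_wpDl.
have m0 : 0 < m by rewrite divr_gt0// mulr_gt0// mulr_gt0.
pose g h := fun x => h^-1 *: (w (t + h) x - w t x) - dw t x.
have q0 : 0 < eps * m / (2 * c') by rewrite divr_gt0// mulr_gt0.
(* [h < l^-1] puts [l * h] into the range of [expRN_le]. *)
have el0 : 0 < Num.min e l^-1 by rewrite lt_min e0 invr_gt0.
have [h /andP[h0]] := near_left0 (L2norm_near0 (dwP t) q0) el0.
rewrite lt_min => /andP[he hl] gh.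
have gL2 : L2fun Om (g (- h)).
  by apply: L2funB => //; apply: L2funZ => //; exact: L2funB.
have /(L2form_young mOm ma ac' m0 (wL2 t)) := gL2.
rewrite -/N => err.
have err2 : 2 * `|L2form Om a (w t) (g (- h))| <= eps.
  apply: (le_trans err); rewrite mulrDr.
  have -> : eps = eps / 2 + eps / 2 by field.
  apply: lerD.
    have mE : m * (c' * (N + 1)) = eps / 2.
      by rewrite /m; field; rewrite !gt_eqF.
    rewrite -mE mulrCA ler_wpM2l ?(ltW m0)// ler_wpM2l ?(ltW c0)//; lra.
  rewrite mulrA -ler_pdivlMl ?mulr_gt0 ?invr_gt0//; apply: (le_trans (ltW gh)).
  by rewrite le_eqVlt; apply/orP; left; apply/eqP; field; rewrite !gt_eqF.
have dL2 : L2fun Om (w (t - h) \- w t) by exact: L2funB.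
have := L2form_expand mOm ma ac sa (wL2 (t - h)) (wL2 t); rewrite -/(E _) -/(E _).
have := form_nonneg dL2.
have -> : L2form Om a (w t) (w (t - h) \- w t) =
    - h * (L2form Om a (w t) (dw t) + L2form Om a (w t) (g (- h))).
  rewrite -(L2formDr mOm ma ac)//.
  have hN : - h != 0 by rewrite oppr_eq0 gt_eqF.
  have gwL2 : L2fun Om (dw t \+ g (- h)).
    rewrite (_ : _ \+ _ = fun x => 1 *: dw t x + g (- h) x); first exact: L2fun_lin.
    by apply/funext => x; rewrite scale1r.
  rewrite -(L2formZr mOm ma ac)//; apply: eq_Rintegral => x _.
  by rewrite /g /= (addrC (dw t x)) subrK scalerA mulfV// scale1r.
move=> pos Eeq.
have := hE h; rewrite h0 he => /(_ isT).
have lh1 : l * h <= 1 by rewrite -ler_pdivlMl// mulr1 ltW.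
have lh0 : 0 <= l * h by rewrite mulr_ge0// ltW.
have := @expRN_le (l * h); rewrite lh0 lh1 => /(_ isT) /(ler_wpM2r Et0) ex Eth.
have : h * (l / 2 * E t) <= h * (2 * L2form Om a (w t) (dw t) + eps).
  have := ler_wpM2l (ltW h0) err2.
  have := ler_wpM2l (ltW h0) (ler_norm (L2form Om a (w t) (g (- h)))).
  lra.
by rewrite ler_pM2l.
Qed.

Hypothesis wcont : L2continuous Om w.

(** Expansion around [w t]: Young's inequality puts a small parameter on the fixed function [w t] in
    the mixed term, and everything else is a multiple of the squared distance to [w t]. *)
Lemma energy_continuous : continuous E.
Proof.
move=> t; apply/(@cvgrPdist_le _ _ _ _ (nbhs_filter t)) => eps eps0.
pose c' := `|c| + 1; have c0 : 0 < c' by rewrite ltr_wpDl.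
have ac' x : Om x -> l1norm (a x) <= c'.
  by move=> /ac /le_trans; apply; rewrite (le_trans (ler_norm _))// lerDl.
pose N := L2dot Om (w t) (w t); have N0 : 0 <= N by exact: L2dot_ge0.
have N1 : 0 < N + 1 by rewrite ltr_wpDl.
pose m := eps / (2 * (c' * (N + 1))).
have m0 : 0 < m by rewrite divr_gt0// mulr_gt0// mulr_gt0.
have r0 : 0 < eps / (2 * (c' * (1 + m^-1))).
  by rewrite divr_gt0// !mulr_gt0// addr_gt0// invr_gt0.
apply: filterS (L2norm_near0 (wcont t) r0) => s ws.
have dL2 : L2fun Om (w s \- w t) by exact: L2funB.
rewrite /E (L2form_expand mOm ma ac sa (wL2 s) (wL2 t)).
have := L2form_young mOm ma ac' m0 (wL2 t) dL2.
have := L2form_young mOm ma ac' ltr01 dL2 dL2; rewrite invr1 !mul1r -/N.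
set D := L2dot Om _ _ in ws *; set F1 := L2form _ _ (_ \- _) _; set F2 := L2form _ _ _ (_ \- _).
move=> h1 h2.
have mE : m * (c' * (N + 1)) = eps / 2 by rewrite /m; field; rewrite !gt_eqF.
have DE : c' * (1 + m^-1) * D <= eps / 2.
  rewrite -ler_pdivlMl; last by rewrite mulr_gt0// addr_gt0// invr_gt0.
  apply: (le_trans (ltW ws)); rewrite le_eqVlt; apply/orP; left; apply/eqP.
  by field; rewrite !gt_eqF//= addr_gt0// ltr01.
have m1 : 0 <= m * c' by rewrite mulr_ge0// ltW.
have f1 := ler_norm F1; have f1' := ler_norm (- F1); rewrite normrN in f1'.
have f2 := ler_norm F2; have f2' := ler_norm (- F2); rewrite normrN in f2'.
by rewrite ler_norml; apply/andP; split; nra.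
Qed.

Hypothesis w0 : forall t, t < 0 -> L2dot Om (w t) (w t) = 0.

(** By continuity from negative times. It settles the case of a maximum at time 0, where no left
    increment is available. *)
Lemma L2dot_initial : L2dot Om (w 0) (w 0) = 0.
Proof.
apply/eqP; rewrite eq_le L2dot_ge0 andbT; apply/ler_addgt0Pr => eps eps0.
have eps2 : 0 < eps / 2 by rewrite divr_gt0.
have [t /andP[t0 _] wt] :=
  near_left0 (nbhs_dnbhs (L2norm_near0 (wcont 0) eps2)) ltr01.
have dL2 : L2fun Om (w (- t) \- w 0) by exact: L2funB.
have := L2dotD_le mOm (wL2 (- t)) (L2funZ mOm (-1) dL2).
have -> : w (- t) \+ (fun x => -1 *: (w (- t) \- w 0) x) = w 0.
  by apply/funext => x /=; rewrite scaleN1r opprB addrC subrK.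
have -> : L2dot Om (w (- t)) (w (- t)) = 0 by rewrite w0// oppr_lt0.
rewrite mulr0 add0r add0r => /le_trans; apply.
rewrite [X in 2 * X](_ : _ = L2dot Om (w (- t) \- w 0) (w (- t) \- w 0)).
  by move: wt; lra.
by apply: eq_Rintegral => x _; rewrite dotvZl dotvZr mulrA mulrNN !mul1r.
Qed.

(* At a maximum point of [exp (- l t) E t] the energy is maximal up to that
   time, which absorbs the memory terms. *)
Lemma energy_estimate (T K delta : R) : 0 <= K -> 0 <= delta -> 0 <= T ->
  (forall t M, 0 <= t <= T ->
    (forall s, s <= t -> L2dot Om (w s) (w s) <= M) ->
    2 * L2form Om a (w t) (dw t) <= K * M + delta) ->
  forall t, 0 <= t <= T ->
  L2dot Om (w t) (w t) <= Clo^-1 * expR (2 * (K / Clo + 1) * T) * delta.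
Proof.
(* [l / 2] exceeds the factor [K / Clo] of the absorbed term by exactly 1, which leaves
   [E r <= delta]. *)
move=> K0 delta0 T0 hK t t0T; pose l := 2 * (K / Clo + 1).
have KC : 0 <= K / Clo by rewrite divr_ge0// ltW.
have l0 : 0 < l by rewrite mulr_gt0// ltr_wpDl.
have E0 s : 0 <= E s by exact: form_nonneg.
pose y s := expR (- (l * s)) * E s.
have ycont : {within `[0, T], continuous y}.
  apply: continuous_subspaceT => s; apply: cvgM; last exact: energy_continuous.
  apply: (@continuous_comp _ _ _ (fun s => - (l * s)) expR).
    by apply: cvgN; apply: cvgM; [exact: cvg_cst|exact: cvg_id].
  exact: continuous_expR.
have [r r0T ymax] := EVT_max T0 ycont.
have /andP[r0 rT] : 0 <= r <= T by move: r0T; rewrite in_itv.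
have Emax s : 0 <= s <= T -> E s <= expR (l * (s - r)) * E r.
  move=> s0T; have := ymax s; rewrite in_itv/= => /(_ s0T).
  rewrite -(ler_pM2l (expR_gt0 (l * s))) /y !mulrA -!expRD subrr expR0 mul1r.
  by rewrite -mulrN -mulrDr.
have Er : E r <= delta.
  have [r00|rpos] := eqVneq r 0.
    have := L2form_young mOm ma ac ltr01 (wL2 r) (wL2 r).
    rewrite r00 L2dot_initial !mulr0 addr0 mulr0 => h.
    apply: le_trans delta0; have := ler_norm (L2form Om a (w 0) (w 0)).
    by rewrite /E; lra.
  have {}rpos : 0 < r by rewrite lt0r rpos.
  have := @energy_left_increment r l r l0 rpos.
  have hdec h : 0 < h < r -> E (r - h) <= expR (- (l * h)) * E r.
    move=> /andP[h0 hr]; have := Emax (r - h).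
    rewrite addrAC subrr add0r mulrN; apply; apply/andP; split; lra.
  move=> /(_ hdec) incr.
  have /hK : 0 <= r <= T by rewrite r0.
  (* The value [M = Clo^-1 * E r] is admissible: by coercivity [L2dot Om (w s) (w s)] is at most
     [Clo^-1 * E s], and [E s <= E r] for [s <= r]. *)
  move=> /(_ (Clo^-1 * E r)) -/(_ _)/(le_trans incr) => h.
  suff : l / 2 * E r <= K * (Clo^-1 * E r) + delta.
    rewrite /l; set q := K / Clo.
    have -> : K * (Clo^-1 * E r) = q * E r by rewrite mulrA.
    have -> : 2 * (q + 1) / 2 * E r = q * E r + E r by field.
    by rewrite lerD2l.
  apply: h => s sr; rewrite ler_pdivlMl//.
  apply: le_trans (energy_lower s) _.
  have [s0|s0] := ltP s 0.
    have := L2form_young mOm ma ac ltr01 (wL2 s) (wL2 s).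
    rewrite w0// !mulr0 addr0 mulr0 => h; apply: le_trans (E0 r).
    have := ler_norm (L2form Om a (w s) (w s)).
    by rewrite /E; lra.
  have /Emax/le_trans : 0 <= s <= T by rewrite s0 (le_trans sr).
  apply; rewrite ler_piMl// -[leRHS]expR0 ler_expR.
  by rewrite pmulr_rle0// subr_le0.
rewrite -mulrA ler_pdivlMl//; apply: le_trans (energy_lower t) _.
apply: le_trans (Emax t t0T) _; apply: ler_pM => //.
by rewrite ler_expR ler_pM2l//; move: t0T => /andP[]; lra.
Qed.

End energy.

(** * The memory term *)

Section weighted_integral.
Context m (S : measurableType m) (R : realType) (k : nat).
Variables (mu : {measure set S -> \bar R}) (D : set S) (mD : measurable D).
Variables (B : S -> 'M[R]_k) (v : S -> 'cV[R]_k).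
Hypothesis mB : forall i j, measurable_fun D (fun s => B s i j).
Hypothesis mv : forall i, measurable_fun D (fun s => v s i 0).
Hypothesis mass_fin : (\int[mu]_(s in D) (l1norm (B s))%:E < +oo)%E.
Hypothesis energy_fin :
  (\int[mu]_(s in D) ((l1norm (B s))%:E * (dotv (v s) (v s))%:E) < +oo)%E.

Let ml1 : measurable_fun D (fun s => l1norm (B s)).
Proof. exact: measurable_l1norm. Qed.

Let mvv : measurable_fun D (fun s => dotv (v s) (v s)).
Proof. by apply: measurable_sum => i; exact: measurable_funM. Qed.

Let mBv i : measurable_fun D (fun s => (B s *m v s) i 0).
Proof.
under eq_fun do rewrite mxE.
by apply: measurable_sum => j; exact: measurable_funM.
Qed.

Let imass : mu.-integrable D (EFin \o (fun s => l1norm (B s))).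
Proof.
apply/integrableP; split; first exact/measurable_EFinP.
by under eq_integral do rewrite /= ger0_norm ?l1norm_ge0//.
Qed.

Let ienergy : mu.-integrable D (EFin \o (fun s => l1norm (B s) * dotv (v s) (v s))).
Proof.
apply/integrableP; split; first exact/measurable_EFinP/measurable_funM.
by under eq_integral do
  rewrite /= ger0_norm ?mulr_ge0 ?l1norm_ge0 ?dotv_ge0// EFinM.
Qed.

Let dotv_delta i (y : 'cV[R]_k) : dotv (delta_mx i 0) y = y i 0.
Proof.
rewrite /dotv (bigD1 i)//= big1 ?addr0 => [|j ji]; first by rewrite mxE !eqxx mul1r.
by rewrite mxE (negbTE ji) mul0r.
Qed.

(** Young's inequality against a basis vector bounds the entry by [l1norm (B s)] plus
    [l1norm (B s) * dotv (v s) (v s)], so finite mass and finite energy suffice. *)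
Lemma integrable_mulmx i : mu.-integrable D (EFin \o (fun s => (B s *m v s) i 0)).
Proof.
apply: (@le_integrable _ _ _ mu _ mD _
    (EFin \o (fun s => l1norm (B s) + l1norm (B s) * dotv (v s) (v s)))).
- exact/measurable_EFinP.
- move=> s _ /=; rewrite lee_fin (le_trans _ (ler_norm _))//.
  have := dotv_mx_young (B s) (delta_mx i 0) (v s) ltr01.
  have -> : dotv (delta_mx i 0 : 'cV[R]_k) (delta_mx i 0) = 1.
    by rewrite dotv_delta mxE !eqxx.
  rewrite dotv_delta invr1 !mul1r mulrDr mulr1.
  by have := normr_ge0 ((B s *m v s) i 0); lra.
- exact: integrable_addr.
Qed.

Let integral_dotv (y : 'cV[R]_k) :
  \int[mu]_(s in D) dotv y (B s *m v s) =
  dotv y (\col_i \int[mu]_(s in D) (B s *m v s) i 0).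
Proof.
rewrite /dotv; transitivity (\sum_(i < k) \int[mu]_(s in D) (y i 0 * (B s *m v s) i 0)).
  elim: (index_enum _) => [|i r ih].
    by rewrite big_nil; under eq_Rintegral do rewrite big_nil; rewrite Rintegral_cst// mul0r.
  rewrite big_cons -ih -RintegralD//.
  - by apply: eq_Rintegral => s _; rewrite big_cons.
  - by apply: integrable_mulr => //; exact: integrable_mulmx.
  elim: r {ih} => [|j r ih].
    by under eq_fun do rewrite big_nil; exact: integrable0.
  under eq_fun do rewrite big_cons.
  by apply: integrable_addr => //; apply: integrable_mulr => //; exact: integrable_mulmx.
apply: eq_bigr => i _; rewrite mxE RintegralZl//; exact: integrable_mulmx.
Qed.

(** Young's inequality under the integral sign: [y] does not depend on [s], so its term collects the
    total mass of the kernel. *)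
Lemma dotv_integral_young (y : 'cV[R]_k) (e l : R) : 0 < l ->
  (\int[mu]_(s in D) (l1norm (B s))%:E <= e%:E)%E ->
  ((2 * `|dotv y (\col_i \int[mu]_(s in D) (B s *m v s) i 0)|)%:E <=
   (e * l * dotv y y)%:E +
   l^-1%:E * \int[mu]_(s in D) ((l1norm (B s))%:E * (dotv (v s) (v s))%:E))%E.
Proof.
move=> l0 massle.
have i1 := integrable_mulr mD (l * dotv y y) imass.
have i2 := integrable_mulr mD l^-1 ienergy.
have i3 : mu.-integrable D (EFin \o (fun s => dotv y (B s *m v s))).
  apply: (@le_integrable _ _ _ mu _ mD _ (EFin \o (fun s =>
     l * dotv y y * l1norm (B s) + l^-1 * (l1norm (B s) * dotv (v s) (v s))))).
  - apply/measurable_EFinP; apply: measurable_sum => i.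
    by apply: measurable_funM => //; exact: measurable_cst.
  - move=> s _ /=; rewrite lee_fin (le_trans _ (ler_norm _))//.
    have := dotv_mx_young (B s) y (v s) l0.
    by have := normr_ge0 (dotv y (B s *m v s)); lra.
  - exact: integrable_addr.
rewrite -integral_dotv.
rewrite (_ : \int[mu]_(s in D) _ = (\int[mu]_(s in D)
   (l1norm (B s) * dotv (v s) (v s)))%R%:E)%E; last first.
  by rewrite fineK//; exact: integrable_fin_num.
rewrite -EFinM -EFinD lee_fin.
apply: (@le_trans _ _ (\int[mu]_(s in D)
   (l * dotv y y * l1norm (B s) + l^-1 * (l1norm (B s) * dotv (v s) (v s))))).
  apply: (@le_trans _ _ (\int[mu]_(s in D) (2 * `|dotv y (B s *m v s)|))).
    rewrite RintegralZl//; last exact: integrable_norm.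
    by rewrite ler_wpM2l// le_normr_Rintegral.
  apply: le_Rintegral => //.
  - by apply: integrable_mulr => //; exact: integrable_norm.
  - exact: integrable_addr.
  move=> s _; apply: le_trans (dotv_mx_young _ _ _ l0) _.
  by rewrite le_eqVlt; apply/orP; left; apply/eqP; ring.
rewrite RintegralD// !RintegralZl// lerD2r -[leRHS]mulrA [leRHS]mulrC ler_wpM2l//.
  by rewrite mulr_ge0 ?dotv_ge0// ltW.
rewrite -lee_fin; apply: le_trans massle.
by rewrite fineK//; exact: integrable_fin_num.
Qed.

End weighted_integral.

Section memory.
Context {R : realType} {d k : nat} (Om : set 'rV[R]_d).
Hypothesis mOm : measurable Om.
Local Notation mu := (lebesgue_rV d).
Local Notation leb := (@lebesgue_measure R).
Implicit Types (q r : R -> 'rV[R]_d -> 'M[R]_k) (u v : R -> 'rV[R]_d -> 'cV[R]_k).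

(** A majorant [G] stands in for the essential supremum over [x] at each time; a difference of
    kernels is then bounded by adding majorants. *)
Record kernel_bound r (G : R -> \bar R) (C : R) : Prop := {
  ker_meas : jointly_measurable Om r;
  ker_causal : forall t x, t < 0 -> Om x -> r t x = 0;
  ker_dom_meas : measurable_fun (setT : set (measurableTypeR R)) G;
  ker_dom_ge0 : forall s, (0 <= G s)%E;
  ker_dom : forall s, {ae mu, forall x, Om x -> ((l1norm (r s x))%:E <= G s)%E};
  ker_mass : (\int[leb]_s G s <= C%:E)%E }.

Record bounded_field v (t M : R) : Prop := {
  fld_meas : jointly_measurable Om v;
  fld_causal : causal Om v;
  fld_L2 : forall s, L2fun Om (v s);
  fld_bound : forall s, 0 <= s <= t -> L2dot Om (v s) (v s) <= M }.

Definition mass r t x : \bar R :=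
  (\int[leb]_(s in `[0%R, t]) (l1norm (r (t - s)%R x))%:E)%E.

(** The quantity I(t, x) of the overview, as [mass] is its Q(x). Both are extended reals, so that
    they can be integrated over [x] before finiteness is known. *)
Definition memory_energy r v t x : \bar R :=
  (\int[leb]_(s in `[0%R, t])
     ((l1norm (r (t - s)%R x))%:E * (dotv (v s x) (v s x))%:E))%E.

Let rho r := fun z : measurableTypeR R * 'rV[R]_d => (l1norm (r z.1 z.2))%:E.
Let nu v := fun z : measurableTypeR R * 'rV[R]_d => (dotv (v z.1 z.2) (v z.1 z.2))%:E.

Let mrho r : jointly_measurable Om r -> measurable_fun (setT `*` Om) (rho r).
Proof. by move=> mr; apply/measurable_EFinP; exact: measurable_l1norm. Qed.

Let mnu v : jointly_measurable Om v -> measurable_fun (setT `*` Om) (nu v).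
Proof.
move=> mv; apply/measurable_EFinP; apply: measurable_sum => i.
exact: measurable_funM.
Qed.

Let rho0 r z : (0 <= rho r z)%E. Proof. by rewrite lee_fin l1norm_ge0. Qed.

Let nu0 v z : (0 <= nu v z)%E. Proof. by rewrite lee_fin dotv_ge0. Qed.

Lemma kernel_bound_ge0 r G C : kernel_bound r G C -> 0 <= C.
Proof.
case=> _ _ _ G0 _ GC; rewrite -lee_fin; apply: le_trans GC.
exact: integral_ge0.
Qed.

Lemma kernel_boundB r1 r2 G1 G2 C1 C2 : kernel_bound r1 G1 C1 ->
  kernel_bound r2 G2 C2 ->
  kernel_bound (fun t => r1 t \- r2 t) (fun s => G1 s + G2 s)%E (C1 + C2).
Proof.
move=> [m1 c1 mG1 G10 d1 M1] [m2 c2 mG2 G20 d2 M2]; split.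
- by move=> i j; under eq_fun do rewrite !mxE; exact: measurable_funB.
- by move=> t x t0 Omx /=; rewrite c1// c2// subr0.
- exact: emeasurable_funD.
- by move=> s; rewrite adde_ge0.
- move=> s; apply: filterS2 (d1 s) (d2 s) => x h1 h2 Omx.
  apply: le_trans (leeD (h1 Omx) (h2 Omx)); rewrite -EFinD lee_fin.
  by apply: le_trans (l1normD _ _) _; rewrite l1normN.
- by rewrite ge0_integralD// EFinD leeD.
Qed.

Lemma bounded_fieldB u v t M N : bounded_field u t M -> bounded_field v t N ->
  bounded_field (fun s => u s \- v s) t (2 * M + 2 * N).
Proof.
move=> [m1 c1 L1 b1] [m2 c2 L2 b2]; split.
- by move=> i j; under eq_fun do rewrite !mxE; exact: measurable_funB.
- move=> s s0; apply: filterS2 (c1 _ s0) (c2 _ s0) => x h1 h2 Omx /=.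
  by rewrite h1// h2// subrr.
- by move=> s; exact: L2funB.
- move=> s st; have L3 : L2fun Om (fun x => -1 *: v s x) by exact: L2funZ.
  rewrite (_ : u s \- v s = u s \+ (fun x => -1 *: v s x)); last first.
    by apply/funext => x /=; rewrite scaleN1r.
  apply: le_trans (L2dotD_le mOm (L1 s) L3) _.
  rewrite lerD ?ler_wpM2l ?b1//.
  rewrite (_ : L2dot _ _ _ = L2dot Om (v s) (v s)); first exact: b2.
  by apply: eq_Rintegral => x _; rewrite dotvZl dotvZr mulrA mulrNN !mul1r.
Qed.

Section one_kernel.
Variables (r : R -> 'rV[R]_d -> 'M[R]_k) (G : R -> \bar R) (C : R).
Hypothesis kr : kernel_bound r G C.

Lemma ae_mass_le t : {ae mu, forall x, Om x -> (mass r t x <= C%:E)%E}.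
Proof.
case: kr => m1 c1 mG1 G10 d1 M1.
apply: filterS (ae_conv_mass_le mOm (mrho m1) (rho0 r) mG1 G10 d1 t) => x h Omx.
exact: le_trans (h Omx) M1.
Qed.

Lemma mass_le t T x : Om x -> t <= T ->
  (mass r t x <= \int[leb]_(s in `[0%R, T]) (l1norm (r s x))%:E)%E.
Proof.
case: kr => m1 _ _ _ _ _ Omx tT.
exact: (conv_mass_le mOm (mrho m1) (rho0 r)).
Qed.

Lemma measurable_memory_energy v t : jointly_measurable Om v ->
  measurable_fun Om (memory_energy r v t).
Proof.
case: kr => m1 _ _ _ _ _ mv.
exact: (measurable_conv mOm (mrho m1) (rho0 r) (mnu mv) (nu0 v)).
Qed.

Lemma memory_energy_ge0 v t x : (0 <= memory_energy r v t x)%E.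
Proof.
by apply: integral_ge0 => s _; rewrite mule_ge0// lee_fin ?l1norm_ge0 ?dotv_ge0.
Qed.

Lemma integral_memory_energy_le v t (B : set 'rV[R]_d) (M : R) :
  jointly_measurable Om v -> measurable B -> B `<=` Om -> 0 <= M ->
  (forall s, 0 <= s <= t ->
    (\int[mu]_(x in B) (dotv (v s x) (v s x))%:E <= M%:E)%E) ->
  (\int[mu]_(x in B) memory_energy r v t x <= (M * C)%:E)%E.
Proof.
case: kr => m1 c1 mG1 G10 d1 M1 mv mB BOm M0 vM.
apply: le_trans (integral_conv_le mOm (mrho m1) (rho0 r) mG1 G10 d1 (mnu mv) (nu0 v)
  mB BOm _ vM) _; first by rewrite lee_fin.
by rewrite EFinM lee_wpmul2l// lee_fin.
Qed.

(** The maximum with 0 covers [t < 0], where no time lies in [[0, t]] and [M] may be negative. *)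
Lemma bounded_field_integral v t M : bounded_field v t M ->
  (\int[mu]_(x in Om) memory_energy r v t x <= (Num.max M 0 * C)%:E)%E.
Proof.
case=> mv _ L2 b; apply: integral_memory_energy_le => //.
  by rewrite le_max lexx orbT.
by move=> s st; rewrite L2dotE// lee_fin le_max b.
Qed.

(** A finite integral forces finite values almost everywhere. Together with finite mass this makes
    the convolution integral at [x] converge. *)
Lemma ae_memory_energy_fin v t M : bounded_field v t M ->
  {ae mu, forall x, Om x -> (memory_energy r v t x < +oo)%E}.
Proof.
move=> bv; have me : mu.-integrable Om (memory_energy r v t).
  apply/integrableP; split; first by apply: measurable_memory_energy; case: bv.
  under eq_integral do rewrite gee0_abs ?memory_energy_ge0//.
  exact: le_lt_trans (bounded_field_integral bv) (ltry _).
by apply: filterS (integrable_ae mOm me) => x h /h; rewrite fin_numE ltey => /andP[].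
Qed.

Let measurable_sec (f : measurableTypeR R * 'rV[R]_d -> R) x :
  measurable_fun (setT `*` Om) f -> Om x ->
  measurable_fun setT (fun s : measurableTypeR R => f (s, x)).
Proof.
move=> mf Omx; apply/measurable_EFinP.
apply: (measurable_section2 mOm (f := EFin \o f)) => //.
exact/measurable_EFinP.
Qed.

Let mrs t x i j : Om x ->
  measurable_fun setT (fun s : measurableTypeR R => r (t - s) x i j).
Proof.
case: kr => m1 _ _ _ _ _ Omx.
apply: (@measurableT_comp _ _ _ _ _ _ (fun s : measurableTypeR R => r s x i j)).
  exact: (measurable_sec (m1 i j)).
exact: measurable_reflect.
Qed.

Let mvs v x i : jointly_measurable Om v -> Om x ->
  measurable_fun setT (fun s : measurableTypeR R => v s x i 0).
Proof. by move=> mv; exact: (measurable_sec (mv i 0)). Qed.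

(* The kernel vanishes at negative times, and so does the field for almost every
   [x] at almost every negative time. *)
Lemma ae_conv_itv v t M : bounded_field v t M -> {ae mu, forall x, Om x ->
  Defs.conv r v t x = \col_i \int[leb]_(s in `[0, t]) (r (t - s) x *m v s x) i 0}.
Proof.
case=> mv cv L2 b.
pose N := (setT `*` Om) `&`
  [set z : measurableTypeR R * 'rV[R]_d | (((z.1 < 0)%R)%:R%:E * nu v z != 0)%E].
have mX : measurable (setT `*` Om : set (measurableTypeR R * 'rV[R]_d)).
  exact: measurableX.
have mN : measurable N.
  apply: emeasurable_neq => //; apply: emeasurable_funM; last exact: mnu.
  apply/measurable_EFinP; apply: measurable_funTS.
  rewrite (_ : (fun z => _) = (\1_(`]-oo, 0%R[%classic) : R -> R) \o fst).
    apply: measurableT_comp; last exact: measurable_fst.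
    by apply: measurable_indic; exact: measurable_itv.
  by apply/funext => z /=; rewrite indicE mem_setE in_itv.
have : {ae mu, forall x, {ae leb, forall s, ~ N (s, x)}}.
  apply: negligible_sections => // s; have [s0|s0] := ltP s 0.
    apply: filterS (cv _ s0) => x h [/= [_ Omx]].
    by rewrite /nu /= h// dotv0r mule0 eqxx.
  by apply/aeW => x [/= _]; rewrite ltNge s0 mul0e eqxx.
apply: filterS => x aes Omx; apply/colP => i; rewrite !mxE [RHS]Rintegral_mkcond.
congr fine; apply: (@ae_eq_integral _ _ _ leb setT) => //.
- apply/measurable_EFinP; under eq_fun do rewrite mxE.
  by apply: measurable_sum => j; apply: measurable_funM; [exact: mrs|exact: mvs].
- apply/measurable_EFinP; apply/(measurable_restrictT _ _).1 => //.
  apply: measurable_funTS; under eq_fun do rewrite mxE.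
  by apply: measurable_sum => j; apply: measurable_funM; [exact: mrs|exact: mvs].
apply: (@filterS _ _ (ae_filter_ringOfSetsType leb) _ _ _ aes) => s Ns _ /=.
rewrite patchE; case: ifPn => //; rewrite mem_setE in_itv/= negb_and -!ltNge.
move=> /orP[s0|ts]; last first.
  by rewrite (ker_causal kr) ?subr_lt0// mul0mx mxE.
rewrite (_ : v s x = 0) ?mulmx0 ?mxE//; apply: dotv_eq0.
apply: contrapT => nz; apply: Ns; split => //=.
by rewrite s0 mul1e /nu/= eqe; apply/eqP.
Qed.

Lemma ae_conv_integrable v t M : bounded_field v t M ->
  {ae mu, forall x, Om x -> forall i, leb.-integrable `[0, t]
    (EFin \o (fun s => (r (t - s) x *m v s x) i 0))}.
Proof.
move=> bv; apply: filterS2 (ae_memory_energy_fin bv) (ae_mass_le t) => x h1 h2 Omx i.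
apply: integrable_mulmx => //.
- by move=> i' j; apply: measurable_funTS; exact: mrs.
- by move=> i'; apply: measurable_funTS; apply: mvs => //; case: bv.
- exact: le_lt_trans (h2 Omx) (ltry _).
- exact: h1.
Qed.

(** [y], [e] and [l] are quantified inside the almost-everywhere statement and may thus depend on
    [x]: later [y] is [w t x], and for the difference of kernels [e] is [theta x] and [l] its
    inverse. *)
Lemma ae_conv_pairing v t M : bounded_field v t M ->
  {ae mu, forall x, Om x -> forall y e l, 0 < l -> (mass r t x <= e%:E)%E ->
    ((2 * `|dotv y (Defs.conv r v t x)|)%:E <=
     (e * l * dotv y y)%:E + l^-1%:E * memory_energy r v t x)%E}.
Proof.
move=> bv.
apply: filterS2 (ae_memory_energy_fin bv) (ae_conv_itv bv) => x h1 h2 Omx y e l l0 he.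
rewrite h2//; apply: dotv_integral_young => //.
- by move=> i' j; apply: measurable_funTS; exact: mrs.
- by move=> i'; apply: measurable_funTS; apply: mvs => //; case: bv.
- exact: le_lt_trans he (ltry _).
- exact: h1.
Qed.

End one_kernel.

(** The difference of kernels is paired with the second field, which will be the fixed solution.
    Integrability of all four integrands is what allows the real integrals to be added. *)
Lemma ae_convB r1 r2 G1 G2 C1 C2 v1 v2 t M1 M2 :
  kernel_bound r1 G1 C1 -> kernel_bound r2 G2 C2 ->
  bounded_field v1 t M1 -> bounded_field v2 t M2 ->
  {ae mu, forall x, Om x -> Defs.conv r1 v1 t x - Defs.conv r2 v2 t x =
    Defs.conv r1 (fun s => v1 s \- v2 s) t x + Defs.conv (fun s => r1 s \- r2 s) v2 t x}.
Proof.
move=> k1 k2 b1 b2; have k3 := kernel_boundB k1 k2; have b3 := bounded_fieldB b1 b2.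
near=> x => Omx.
have -> : Defs.conv r1 v1 t x = \col_i \int[leb]_(s in `[0, t]) (r1 (t - s) x *m v1 s x) i 0.
  by move: Omx; near: x; exact: (ae_conv_itv k1 b1).
have -> : Defs.conv r2 v2 t x = \col_i \int[leb]_(s in `[0, t]) (r2 (t - s) x *m v2 s x) i 0.
  by move: Omx; near: x; exact: (ae_conv_itv k2 b2).
have -> : Defs.conv r1 (fun s => v1 s \- v2 s) t x =
    \col_i \int[leb]_(s in `[0, t]) (r1 (t - s) x *m (v1 s \- v2 s) x) i 0.
  by move: Omx; near: x; exact: (ae_conv_itv k1 b3).
have -> : Defs.conv (fun s => r1 s \- r2 s) v2 t x =
    \col_i \int[leb]_(s in `[0, t]) ((r1 (t - s) \- r2 (t - s)) x *m v2 s x) i 0.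
  by move: Omx; near: x; exact: (ae_conv_itv k3 b2).
have i1 : forall i, leb.-integrable `[0, t]
    (EFin \o (fun s => (r1 (t - s) x *m v1 s x) i 0)).
  by move: Omx; near: x; exact: (ae_conv_integrable k1 b1).
have i2 : forall i, leb.-integrable `[0, t]
    (EFin \o (fun s => (r2 (t - s) x *m v2 s x) i 0)).
  by move: Omx; near: x; exact: (ae_conv_integrable k2 b2).
have i3 : forall i, leb.-integrable `[0, t]
    (EFin \o (fun s => (r1 (t - s) x *m (v1 s \- v2 s) x) i 0)).
  by move: Omx; near: x; exact: (ae_conv_integrable k1 b3).
have i4 : forall i, leb.-integrable `[0, t]
    (EFin \o (fun s => ((r1 (t - s) \- r2 (t - s)) x *m v2 s x) i 0)).
  by move: Omx; near: x; exact: (ae_conv_integrable k3 b2).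
apply/colP => i; rewrite !mxE -RintegralB// -RintegralD//.
apply: eq_Rintegral => s _ /=.
rewrite -[RHS]/((_ : 'cV_k) i 0 + (_ : 'cV_k) i 0).
by rewrite mulmxBr mulmxBl !mxE addrA subrK.
Unshelve. all: by end_near. Qed.

End memory.

(** * Coefficients and convergence in measure *)

Section essential_bounds.
Context {R : realType} {d k : nat} (Om : set 'rV[R]_d).
Hypothesis mOm : measurable Om.
Variable nrm : 'M[R]_k -> R.
Hypothesis nrmP : is_mxnorm nrm.
Local Notation mu := (lebesgue_rV d).
Local Notation leb := (@lebesgue_measure R).

Lemma ae_Linfnorm (A : 'rV[R]_d -> 'M[R]_k) :
  {ae mu, forall x, Om x -> ((nrm (A x))%:E <= Linfnorm nrm Om A)%E}.
Proof.
rewrite /Linfnorm unlock; case: ifPn => [_|].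
  pose F := abse \o (EFin \o patch (cst 0) Om (fun x => nrm (A x))).
  apply: filterS (ess_sup_ge mu F) => x + Omx.
  by rewrite {1}/F /= /patch mem_set//; apply: le_trans; rewrite lee_fin ler_norm.
(* The norm is 0 by definition on a null space, where every property holds almost everywhere. *)
rewrite lt0e measure_ge0 andbT negbK => /eqP mu0.
by exists setT; split => // x.
Qed.

Lemma Linfnorm_ge0 (A : 'rV[R]_d -> 'M[R]_k) : (0 <= Linfnorm nrm Om A)%E.
Proof. exact: Lnorm_ge0. Qed.

Lemma measurable_mxnorm_joint (q : R -> 'rV[R]_d -> 'M[R]_k) :
  jointly_measurable Om q ->
  measurable_fun (setT `*` Om)
    (fun z : measurableTypeR R * 'rV[R]_d => nrm (q z.1 z.2)).
Proof. by move=> mq; apply: measurable_mxnorm => //; exact: measurableX. Qed.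

(* The sections of a jointly measurable set have measurable measure, so joint
   measurability alone makes the essential supremum measurable in [t]. *)
Lemma measurable_Linfnorm (q : R -> 'rV[R]_d -> 'M[R]_k) :
  jointly_measurable Om q ->
  measurable_fun (setT : set (measurableTypeR R)) (fun t => Linfnorm nrm Om (q t)).
Proof.
move=> mq; have [mu0|mu0] := boolP (0 < mu [set: 'rV[R]_d])%E; last first.
  rewrite (_ : (fun t => _) = cst 0%E); first exact: measurable_cst.
  by apply/funext => t; rewrite /Linfnorm unlock (negbTE mu0).
pose F := (fun z : measurableTypeR R * 'rV[R]_d => nrm (q z.1 z.2)) \_ (setT `*` Om).
have mF : measurable_fun setT F.
  apply/(measurable_restrictT _ _).1; first exact: measurableX.
  exact: measurable_mxnorm_joint.
have FE t x : F (t, x) = patch (cst 0) Om (fun x => nrm (q t x)) x.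
  rewrite /F !patchE /=; congr (if _ then _ else _).
  by apply/idP/idP; rewrite !inE => // -[].
have F0 z : 0 <= F z by rewrite /F patchE; case: ifP => // _; exact: mxnorm_ge0.
apply: (measurability _ (ErealGenOInfty.measurableE R)) => /=.
move=> _ [_ [r ->] <-]; rewrite setTI.
pose N := [set z | r < F z].
have mN : measurable N.
  rewrite (_ : N = F @^-1` `]r, +oo[).
    by rewrite -[X in measurable X]setTI; apply: mF => //; exact: measurable_itv.
  by apply/seteqP; split => z /=; rewrite in_itv/= andbT.
rewrite (_ : _ @^-1` _ = [set t | (0 < mu (xsection N t))%E]).
  rewrite -[X in measurable X]setTI.
  apply: (emeasurable_fun_o_infty measurableT).
  exact: measurable_fun_xsection.
have key t : (Linfnorm nrm Om (q t) <= r%:E)%E <-> mu (xsection N t) = 0%E.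
  rewrite /Linfnorm unlock mu0.
  have xN x : xsection N t x <-> r < F (t, x) by rewrite /xsection/= inE.
  split=> [/ess_supP h|h]; last apply/ess_supP.
    apply/negligibleP; first exact: measurable_xsection.
    apply: negligibleS h => x /xN rF /=; rewrite -FE ger0_norm//.
    by rewrite lee_fin leNgt rF.
  exists (xsection N t); split => //; first exact: measurable_xsection.
  move=> x /= /negP; rewrite -FE lee_fin -ltNge ger0_norm//.
  by move=> h'; apply/xN.
apply/seteqP; split => t /=; rewrite in_itv/= andbT.
  move=> h; rewrite lt0e measure_ge0 andbT; apply/eqP => /key.
  by rewrite leNgt h.
by move=> h; rewrite ltNge; apply/negP => /key h0; rewrite h0 ltxx in h.
Qed.

Variable K : R.
Hypothesis K0 : 0 < K.
Hypothesis hK : forall B, l1norm B <= K * nrm B.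

(** The majorant is [K * Linfnorm] cut off at negative times, since [q_bound] integrates over
    nonnegative times; before time 0 the kernel vanishes by causality. *)
Lemma coefs_kernel (Clo Cup CB CQ : R) a b q :
  coefs nrm Om Clo Cup CB CQ a b q ->
  exists G, kernel_bound Om q G (K * CQ).
Proof.
move=> [_ _ _ _ _ [mq _ _] _ qb qc].
pose H s := (K%:E * Linfnorm nrm Om (q s))%E.
have H0 s : (0 <= H s)%E by rewrite mule_ge0 ?Linfnorm_ge0// lee_fin ltW.
have mI : measurable (`[0%R, +oo[%classic : set (measurableTypeR R)).
  exact: measurable_itv.
exists (H \_ `[0%R, +oo[%classic); split => //.
- apply/(measurable_restrictT _ _).1 => //; apply: measurable_funTS.
  by apply: measurable_funeM; exact: measurable_Linfnorm.
- by move=> s; rewrite patchE; case: ifP.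
- move=> s; apply: filterS (ae_Linfnorm (q s)) => x h Omx.
  rewrite patchE mem_setE in_itv/= andbT; case: ifPn => s0.
    apply: (@le_trans _ _ (K * nrm (q s x))%:E); first by rewrite lee_fin.
    by rewrite EFinM lee_pmul2l// h.
  rewrite qc ?ltNge// lee_fin; apply: sumr_le0 => i _; apply: sumr_le0 => j _.
  by rewrite mxE normr0.
- rewrite -integral_mkcond ge0_integralZl//.
  + by rewrite EFinM lee_pmul2l// ltW.
  + by apply: measurable_funTS; exact: measurable_Linfnorm.
  + by move=> s _; exact: Linfnorm_ge0.
  + by rewrite lee_fin ltW.
Qed.

Lemma ae_b_bound (Clo Cup CB CQ : R) a b q :
  coefs nrm Om Clo Cup CB CQ a b q ->
  {ae mu, forall x, Om x -> l1norm (b x) <= K * CB}.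
Proof.
move=> [_ _ _ _ bb _ _ _ _]; apply: filterS (ae_Linfnorm b) => x h Omx.
apply: le_trans (hK _) _; rewrite ler_pM2l// -lee_fin.
exact: le_trans (h Omx) (ltW bb).
Qed.

(** Unlike the bounds on [b] and [q], this one holds at every point of [Om], as the form bounds on
    [a] do. It depends only on the class, hence not on the index of the sequence. *)
Lemma a_l1norm_bound (Clo Cup CB CQ : R) a b q : 0 < Clo ->
  coefs nrm Om Clo Cup CB CQ a b q ->
  forall x, Om x -> l1norm (a x) <= (k * k)%:R * Cup.
Proof.
move=> Clo0 [_ sa ab _ _ _ _ _ _] x Omx; apply: l1norm_le.
by have [lo up] := ab x Omx; apply: (posdef_entry (ltW Clo0)) => //; exact: sa.
Qed.

Lemma a_lower_bound (Clo Cup CB CQ : R) a b q :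
  coefs nrm Om Clo Cup CB CQ a b q ->
  forall x (y : 'cV[R]_k), Om x -> Clo * dotv y y <= dotv y (a x *m y).
Proof.
move=> [_ _ ab _ _ _ _ _ _] x y Omx; have [lo _] := ab x Omx.
have := posdef_ge0 y lo; rewrite mulmxBl dotvDr dotvNr scalar_dotv.
by rewrite subr_ge0.
Qed.

End essential_bounds.

Section convergence_in_measure.
Context {R : realType} {d k : nat} (Om : set 'rV[R]_d).
Hypothesis mOm : measurable Om.
Local Notation mu := (lebesgue_rV d).
Local Notation leb := (@lebesgue_measure R).

Lemma measurable_lt_set (D : set 'rV[R]_d) (e : R) (f : 'rV[R]_d -> R) :
  measurable D -> measurable_fun D f -> measurable (D `&` [set x | e < f x]).
Proof.
move=> mD mf; rewrite (_ : [set x | _] = f @^-1` `]e, +oo[).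
  by apply: mf => //; exact: measurable_itv.
by apply/seteqP; split => x /=; rewrite in_itv/= andbT.
Qed.

(** If the sum of the entries exceeds [e], some entry exceeds [e / (k * k).+1], so the set is
    covered by finitely many sets of vanishing measure. The successor avoids division by 0 for
    [k = 0]. *)
Lemma cvg_in_measure_l1norm (A_ : nat -> 'rV[R]_d -> 'M[R]_k)
    (A : 'rV[R]_d -> 'M[R]_k) :
  (forall m i j, measurable_fun Om (fun x => A_ m x i j)) ->
  (forall i j, measurable_fun Om (fun x => A x i j)) ->
  cvg_in_measure_mx Om A_ A -> forall e : R, 0 < e ->
  mu (Om `&` [set x | e < l1norm (A_ m x - A x)]) @[m --> \oo] --> 0%E.
Proof.
move=> mA_ mA cA e e0.
pose e' := e / (k * k).+1%:R; have e'0 : 0 < e' by rewrite divr_gt0.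
pose S m (ij : 'I_k * 'I_k) := Om `&`
  [set x | e' < `|A_ m x ij.1 ij.2 - A x ij.1 ij.2|].
have mS m ij : measurable (S m ij).
  apply: measurable_lt_set => //; apply: measurableT_comp => //.
  exact: measurable_funB.
apply: (@squeeze_cvge _ _ _ _ (cst 0%E) _
    (fun m => (\sum_(ij : 'I_k * 'I_k) mu (S m ij))%E)); last 2 first.
- exact: cvg_cst.
- rewrite [X in _ --> X](_ : _ = (\sum_(ij : 'I_k * 'I_k) 0)%E); last by rewrite big1.
  apply: cvg_nnesum => [ij _|ij _].
    by apply: nearW => m; exact: measure_ge0.
  exact: cA.
apply: nearW => m; rewrite measure_ge0/=.
have [mU muU] : measurable (\big[setU/set0]_(ij : 'I_k * 'I_k) S m ij) /\
    (mu (\big[setU/set0]_(ij : 'I_k * 'I_k) S m ij) <=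
     \sum_(ij : 'I_k * 'I_k) mu (S m ij))%E.
  elim/big_rec2 : _ => [|ij y X _ [mX Xy]].
    by rewrite measure0; split => //; exact: measurable0.
  split; first exact: measurableU.
  by apply: le_trans (measureU2 _ _ _) _ => //; rewrite leeD2l.
apply: le_trans muU; apply: le_measure; rewrite ?inE.
- apply: measurable_lt_set => //; apply: measurable_l1norm => i j.
  by under eq_fun do rewrite !mxE; exact: measurable_funB.
- exact: mU.
move=> x [Omx /= el1]; apply: contrapT => nS.
move: el1; apply/negP; rewrite -leNgt.
apply: (@le_trans _ _ ((k * k)%:R * e')).
  apply: l1norm_le => i j; rewrite !mxE leNgt; apply/negP => lt; apply: nS.
  by rewrite -bigcup_seq; exists (i, j); rewrite /= ?mem_index_enum.
rewrite /e' mulrCA ler_piMr ?(ltW e0)// ler_pdivrMr// mul1r.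
by rewrite ler_nat.
Qed.

Variables (nrm : 'M[R]_k -> R) (K : R).
Hypotheses (nrmP : is_mxnorm nrm) (K0 : 0 < K).
Hypothesis hK : forall B, l1norm B <= K * nrm B.

(** The hypothesis concerns a real integral, which is 0 by convention where the integral diverges.
    The kernel bound excludes this for almost every [x]; then the threshold [e / K] for [nrm] yields
    [e] for [l1norm]. *)
Lemma memory_cvg_in_measure (r_ : nat -> R -> 'rV[R]_d -> 'M[R]_k) (T e : R)
    (G : nat -> R -> \bar R) (C : nat -> R) :
  (forall m, kernel_bound Om (r_ m) (G m) (C m)) -> 0 < e ->
  cvg_in_measure Om
    (fun m x => \int[leb]_(s in `[0, T]) nrm (r_ m s x)) (cst 0) ->
  exists B : nat -> set 'rV[R]_d, [/\ forall m, measurable (B m),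
    forall m, B m `<=` Om, mu (B m) @[m --> \oo] --> 0%E &
    forall m, {ae mu, forall x, Om x -> ~ B m x ->
      (\int[leb]_(s in `[0%R, T]) (l1norm (r_ m s x))%:E <= e%:E)%E}].
Proof.
move=> kr e0 cr; have [L L0 hL] := mxnorm_le_l1 nrmP.
have eK : 0 < e / K by rewrite divr_gt0.
exists (fun m => Om `&` [set x | e / K <
  `|\int[leb]_(s in `[0, T]) nrm (r_ m s x) - (cst 0) x|]).
have mI : measurable (`[0%R, T]%classic : set (measurableTypeR R)).
  exact: measurable_itv.
have mX : measurable (setT `*` Om : set (measurableTypeR R * 'rV[R]_d)).
  exact: measurableX.
have mn m : measurable_fun (setT `*` Om)
    (EFin \o (fun z : measurableTypeR R * 'rV[R]_d => nrm (r_ m z.1 z.2))).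
  apply/measurable_EFinP; exact: (measurable_mxnorm_joint mOm nrmP (ker_meas (kr m))).
have n0 m z : (0 <= (EFin \o (fun z : measurableTypeR R * 'rV[R]_d =>
    nrm (r_ m z.1 z.2))) z)%E by rewrite lee_fin mxnorm_ge0.
split.
- move=> m; apply: measurable_lt_set => //; apply: measurableT_comp => //.
  apply: measurable_funB; last exact: measurable_cst.
  apply: measurableT_comp => //.
  apply: (measurable_tonelli2 leb mI mOm _ (n0 m)).
  by apply: measurable_funS (mn m) => //; exact: setSX.
- by move=> m x [].
- exact: cr.
move=> m; have := ae_kernel_mass_le (mu := mu) mOm (rho := fun z => (l1norm (r_ m z.1 z.2))%:E)
  (G := G m).
case: (kr m) => mr _ mG G0 dG MG.
have ml1 : measurable_fun (setT `*` Om)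
    (fun z : measurableTypeR R * 'rV[R]_d => (l1norm (r_ m z.1 z.2))%:E).
  by apply/measurable_EFinP; exact: measurable_l1norm.
have l10 (z : measurableTypeR R * 'rV[R]_d) : (0 <= (l1norm (r_ m z.1 z.2))%:E)%E.
  by rewrite lee_fin l1norm_ge0.
move=> /(_ ml1 l10 mG G0 dG); apply: filterS => x h Omx nB.
have msl : measurable_fun `[0%R, T] (fun s : measurableTypeR R => (l1norm (r_ m s x))%:E).
  apply: measurable_funTS; exact: (measurable_section2 mOm ml1).
have msn : measurable_fun `[0%R, T] (fun s : measurableTypeR R => (nrm (r_ m s x))%:E).
  apply: measurable_funTS; exact: (measurable_section2 mOm (mn m)).
have fin : (\int[leb]_(s in `[0%R, T]) (l1norm (r_ m s x))%:E < +oo)%E.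
  apply: (@le_lt_trans _ _ (\int[leb]_s (l1norm (r_ m s x))%:E)%E).
    apply: ge0_subset_integral => //; first exact: (measurable_section2 mOm ml1).
    by move=> s _; rewrite lee_fin l1norm_ge0.
  by apply: le_lt_trans (h Omx) _; apply: le_lt_trans MG _; exact: ltry.
have nfin : (\int[leb]_(s in `[0%R, T]) (nrm (r_ m s x))%:E < +oo)%E.
  apply: (@le_lt_trans _ _ (L%:E * \int[leb]_(s in `[0%R, T]) (l1norm (r_ m s x))%:E)%E).
    rewrite -ge0_integralZl//; last 2 first.
    - by move=> s _; rewrite lee_fin l1norm_ge0.
    - by rewrite lee_fin ltW.
    apply: ge0_le_integral => //.
    - by move=> s _; rewrite lee_fin mxnorm_ge0.
    - exact: measurable_funeM.
    - by move=> s _; rewrite -EFinM lee_fin.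
  by rewrite lte_mul_pinfty// ?lee_fin ?ltW.
apply: (@le_trans _ _ (K%:E * \int[leb]_(s in `[0%R, T]) (nrm (r_ m s x))%:E)%E).
  rewrite -ge0_integralZl//; last 2 first.
  - by move=> s _; rewrite lee_fin mxnorm_ge0.
  - by rewrite lee_fin ltW.
  apply: ge0_le_integral => //.
  - by move=> s _; rewrite lee_fin l1norm_ge0.
  - exact: measurable_funeM.
  by move=> s _; rewrite -EFinM lee_fin.
rewrite -[X in (_ * X)%E]fineK; last first.
  by rewrite ge0_fin_numE//; apply: integral_ge0 => s _; rewrite lee_fin mxnorm_ge0.
rewrite -EFinM lee_fin -ler_pdivlMl// mulrC.
have : ~ (e / K < `|\int[leb]_(s in `[0, T]) nrm (r_ m s x) - (cst 0) x|).
  by move=> lt; apply: nB.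
by move/negP; rewrite -leNgt /= subr0; apply: le_trans; exact: ler_norm.
Qed.

End convergence_in_measure.

(** * Integrals over sets of vanishing measure *)

Section absolute_continuity.
Context {R : realType} {d k : nat} (Om : set 'rV[R]_d).
Hypothesis mOm : measurable Om.
Local Notation mu := (lebesgue_rV d).
Variable B : nat -> set 'rV[R]_d.
Hypotheses (mB : forall m, measurable (B m)) (BOm : forall m, B m `<=` Om).
Hypothesis muB : mu (B m) @[m --> \oo] --> 0%E.

(** Truncation: [g] is at most [n] plus the excess of [g] over [n]. Dominated convergence makes the
    excess small for some fixed [n], and then [n * mu (B m)] tends to 0. *)
Lemma integral_small_sets (g : 'rV[R]_d -> R) : (forall x, 0 <= g x) ->
  mu.-integrable Om (EFin \o g) -> forall e : R, 0 < e ->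
  \forall m \near \oo, (\int[mu]_(x in B m) (g x)%:E < e%:E)%E.
Proof.
move=> g0 ig e e0.
have mg : measurable_fun Om g by apply/measurable_EFinP; case/integrableP: ig.
pose h n x : R := Num.max (g x - n%:R) 0.
have h0 n x : 0 <= h n x by rewrite le_max lexx orbT.
have mh n : measurable_fun Om (EFin \o h n).
  apply/measurable_EFinP; apply: measurable_maxr; last exact: measurable_cst.
  by apply: measurable_funB => //; exact: measurable_cst.
have : (\int[mu]_(x in Om) (EFin \o h n) x)%E @[n --> \oo] -->
    (\int[mu]_(x in Om) cst 0 x)%E.
  apply: (@dominated_cvg _ _ _ mu Om mOm (fun n => EFin \o h n) (cst 0%E) (EFin \o g)) => //.
    move=> x _; apply: cvg_near_cst; near=> n; rewrite /h /=.
    congr EFin; apply/max_idPr; rewrite subr_le0.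
    near: n; exact: nbhs_infty_ger.
  move=> n x _ /=; rewrite lee_fin ger0_norm// ge_max g0 andbT.
  by rewrite lerBlDr lerDl.
rewrite integral0 => hn.
have e20 : (0 < (e / 2)%:E)%E by rewrite lte_fin divr_gt0.
have [n _ /(_ n (leqnn n)) /= hne] : \forall n \near \oo,
    (\int[mu]_(x in Om) (EFin \o h n) x < (e / 2)%:E)%E.
  have nb : nbhs (0%E : \bar R) [set y | (y < (e / 2)%:E)%E].
    by apply: open_nbhs_nbhs; split => //; exact: open_ereal_lt_ereal.
  exact: (hn _ nb).
(* The successor admits the level [n = 0]. *)
have n1 : 0 < e / 2 / n.+1%:R by rewrite !divr_gt0.
have : \forall m \near \oo, (mu (B m) < (e / 2 / n.+1%:R)%:E)%E.
  have nb : nbhs (0%E : \bar R) [set y | (y < (e / 2 / n.+1%:R)%:E)%E].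
    apply: open_nbhs_nbhs; split; first exact: open_ereal_lt_ereal.
    by rewrite /= lte_fin.
  exact: (@muB _ nb).
apply: filterS => m muBm.
have gle x : ((g x)%:E <= (n%:R)%:E + (EFin \o h n) x)%E.
  by rewrite -EFinD lee_fin -lerBlDl le_max lexx.
apply: (@le_lt_trans _ _ (\int[mu]_(x in B m) ((n%:R)%:E + (EFin \o h n) x))%E).
  apply: ge0_le_integral => //.
  - by move=> x _; rewrite lee_fin.
  - by apply/measurable_EFinP; exact: measurable_funS mg.
  - by apply: emeasurable_funD; [exact: measurable_cst|exact: measurable_funS (mh n)].
rewrite ge0_integralD//; last 2 first.
- by move=> x _; rewrite lee_fin.
- exact: measurable_funS (mh n).
have -> : e%:E = ((e / 2)%:E + (e / 2)%:E)%E.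
  by rewrite -EFinD; congr EFin; field.
rewrite integral_cst//; apply: lee_ltD => //.
- by rewrite ge0_fin_numE ?mule_ge0// lte_mul_pinfty// (lt_trans muBm)// ltry.
- apply: (@le_trans _ _ ((n%:R)%:E * (e / 2 / n.+1%:R)%:E)%E).
    by rewrite lee_wpmul2l// ltW.
  rewrite -EFinM lee_fin mulrCA ler_piMr ?divr_ge0 ?(ltW e0)//.
  by rewrite ler_pdivrMr// mul1r ler_nat.
apply: le_lt_trans hne; apply: ge0_subset_integral => //.
by move=> x _; rewrite lee_fin.
Unshelve. all: by end_near. Qed.

Variable v : R -> 'rV[R]_d -> 'cV[R]_k.
Hypotheses (vL2 : forall t, L2fun Om (v t)) (vcont : L2continuous Om v).

Lemma L2dot_triangle s t :
  L2dot Om (v s) (v s) <= 2 * L2dot Om (v t) (v t) +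
                          2 * L2dot Om (v s \- v t) (v s \- v t).
Proof.
have := L2dotD_le mOm (vL2 t) (L2funB mOm (vL2 s) (vL2 t)).
by rewrite (_ : v t \+ _ = v s)//; apply/funext => x /=; rewrite addrC subrK.
Qed.

(** Compactness in its near-covering form, with the integer [n] of the filter as the candidate
    bound: local bounds near each time yield one for the whole interval. *)
Lemma L2dot_bounded (T : R) :
  exists M : R, forall t, 0 <= t <= T -> L2dot Om (v t) (v t) <= M.
Proof.
have := (compact_near_coveringP `[0, T]%classic).1 (@segment_compact _ 0 T).
move=> /(_ nat \oo (fun n t => L2dot Om (v t) (v t) <= n%:R) _) [].
  move=> t _.
  have nt := L2norm_near0 (FF := nbhs_filter t) (vcont t) ltr01.
  have nn : \forall n \near \oo, 2 * L2dot Om (v t) (v t) + 2 <= n%:R :> R.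
    exact: nbhs_infty_ger.
  exists ([set s | L2dot Om (v s \- v t) (v s \- v t) < 1],
    [set n | 2 * L2dot Om (v t) (v t) + 2 <= n%:R]) => //.
  move=> [s n] /= [hs hn]; apply: le_trans hn; apply: le_trans (L2dot_triangle s t) _.
  by rewrite lerD2l -[leRHS]mulr1 ler_wpM2l// ltW.
move=> n _ /(_ n (leqnn n)) h; exists n%:R => t t0T.
by apply: h; rewrite /= in_itv.
Qed.

(* Compactness of [0, T] makes the smallness uniform in time. *)
Lemma uniform_small_sets (T e : R) : 0 < e ->
  \forall m \near \oo, forall t, 0 <= t <= T ->
    (\int[mu]_(x in B m) (dotv (v t x) (v t x))%:E < e%:E)%E.
Proof.
move=> e0; have := (compact_near_coveringP `[0, T]%classic).1 (@segment_compact _ 0 T).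
pose P m t := (\int[mu]_(x in B m) (dotv (v t x) (v t x))%:E < e%:E)%E.
move=> /(_ nat \oo P _) h.
have {}h : \forall m \near \oo, `[0, T]%classic `<=` P m.
  apply: h => t _.
  (* The squared triangle inequality costs a factor 2: [2 * (e / 4)] for [v t] over [B m], and as
     much for the distance to [v t], taken over all of [Om]. *)
  have e40 : 0 < e / 4 by rewrite divr_gt0.
  have nt := L2norm_near0 (FF := nbhs_filter t) (vcont t) e40.
  have nn := integral_small_sets (fun x => dotv_ge0 (v t x)) (integrable_dotv mOm (vL2 t) (vL2 t)) e40.
  exists ([set s | L2dot Om (v s \- v t) (v s \- v t) < e / 4],
    [set m | (\int[mu]_(x in B m) (dotv (v t x) (v t x))%:E < (e / 4)%:E)%E]) => //.
  move=> [s m] /= [hs hm]; rewrite /P.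
  have mS (w : 'rV[R]_d -> 'cV[R]_k) : L2fun Om w -> measurable_fun (B m) (fun x => (dotv (w x) (w x))%:E).
    move=> [mw _]; apply/measurable_EFinP.
    by apply: measurable_funS (measurable_dotv mw mw).
  have wL2 := L2funB mOm (vL2 s) (vL2 t).
  have m1 := mS _ (vL2 t); have m2 := mS _ wL2.
  apply: (@le_lt_trans _ _ (2%:E * \int[mu]_(x in B m) (dotv (v t x) (v t x))%:E +
     2%:E * \int[mu]_(x in B m) (dotv ((v s \- v t) x) ((v s \- v t) x))%:E)%E).
    rewrite -!ge0_integralZl//; try (by move=> x _; rewrite lee_fin dotv_ge0).
    rewrite -ge0_integralD//; last 4 first.
    - by move=> x _; rewrite -EFinM lee_fin mulr_ge0// dotv_ge0.
    - exact: measurable_funeM.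
    - by move=> x _; rewrite -EFinM lee_fin mulr_ge0// dotv_ge0.
    - exact: measurable_funeM.
    apply: ge0_le_integral => //.
    - by move=> x _; rewrite lee_fin dotv_ge0.
    - exact: mS.
    - by apply: emeasurable_funD; exact: measurable_funeM.
    move=> x _; rewrite -!EFinM -EFinD lee_fin.
    have := dotvD_le (v t x) (v s x - v t x).
    by rewrite (_ : v t x + _ = v s x)// addrC subrK.
  have wB : (\int[mu]_(x in B m) (dotv ((v s \- v t) x) ((v s \- v t) x))%:E < (e / 4)%:E)%E.
    apply: (@le_lt_trans _ _ (\int[mu]_(x in Om) (dotv ((v s \- v t) x) ((v s \- v t) x))%:E)%E).
      apply: ge0_subset_integral => //.
        by apply/measurable_EFinP; apply: measurable_dotv => //; case: wL2.
      by move=> x _; rewrite lee_fin dotv_ge0.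
    by rewrite (L2dotE mOm wL2) lte_fin.
  have -> : e%:E = (2%:E * (e / 4)%:E + 2%:E * (e / 4)%:E)%E.
    by rewrite -!EFinM -EFinD; congr EFin; field.
  apply: lteD; by rewrite lte_pmul2l// lte_fin.
by apply: filterS h => m h t t0T; apply: h; rewrite /= in_itv.
Qed.

End absolute_continuity.

(** * The equation for the difference *)

Section skew_adjoint_operator.
Context {R : realType} {d k : nat} (Om : set 'rV[R]_d).
Hypothesis mOm : measurable Om.
Variables (V : set ('rV[R]_d -> 'cV[R]_k))
  (P : ('rV[R]_d -> 'cV[R]_k) -> 'rV[R]_d -> 'cV[R]_k).
Hypothesis VP : skew_adjoint Om V P.

(** The pair of [v] and [- P v] lies in the graph of the adjoint; tested with [v] itself it gives a
    number equal to its opposite. *)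
Lemma skew_adjoint_dot v : V v -> L2dot Om (P v) v = 0.
Proof.
move=> Vv; have [vL2 PvL2] := V_L2 VP Vv.
have NL2 : L2fun Om (fun x => - P v x).
  rewrite (_ : (fun x => _) = fun x => -1 *: P v x); first exact: L2funZ.
  by apply/funext => x; rewrite scaleN1r.
have [_ _ adj] : adjoint_graph Om V P v (fun x => - P v x).
  by apply/(P_adjoint VP); split => //; apply/aeW.
have := adj v Vv.
rewrite (_ : L2dot Om v _ = - L2dot Om (P v) v); first by move=> h; lra.
rewrite -mulN1r -RintegralZl//; last exact: integrable_dotv.
by apply: eq_Rintegral => x _; rewrite dotvNr dotvC mulN1r.
Qed.

Lemma skew_adjointB u v : V u -> V v ->
  V (u \- v) /\
  {ae lebesgue_rV d, forall x, Om x -> P (u \- v) x = P u x - P v x}.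
Proof.
move=> Vu Vv; have [Vw Pw] := V_linear VP (-1) Vv Vu.
have E : (fun x => -1 *: v x + u x) = u \- v.
  by apply/funext => x; rewrite scaleN1r addrC.
rewrite -E; split=> //; apply: filterS Pw => x h /h ->.
by rewrite scaleN1r addrC.
Qed.

Lemma V_norm_L2continuous nV (u : R -> 'rV[R]_d -> 'cV[R]_k) :
  is_V_norm Om V P nV -> (forall t, V (u t)) ->
  (forall t, nV (u s \- u t) @[s --> t] --> 0) -> L2continuous Om u.
Proof.
move=> [_ _ [c1 [c2 [c10 c20 eqv]]]] Vu uc t.
have le s : L2norm Om (u s \- u t) <= c1^-1 * nV (u s \- u t).
  rewrite ler_pdivlMl//.
  have /andP[h _] := eqv _ (skew_adjointB (Vu s) (Vu t)).1.
  apply: le_trans h; rewrite ler_pM2l//.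
  rewrite -[leLHS]ger0_norm ?sqrtr_ge0// -sqrtr_sqr ler_sqrt.
    by rewrite lerDl sqr_ge0.
  by rewrite addr_ge0// sqr_ge0.
have c0 : cst 0 s @[s --> t] --> (0 : R) by exact: cvg_cst.
apply: (squeeze_cvgr _ c0 (h := fun s => c1^-1 * nV (u s \- u t))).
- by apply: nearW => s; rewrite sqrtr_ge0 le.
- by rewrite -(mulr0 c1^-1); apply: cvgM; [exact: cvg_cst|exact: uc].
Qed.

End skew_adjoint_operator.

(** * The rate of change of the energy *)

Section energy_rate.
Context {R : realType} {d k : nat} (Om : set 'rV[R]_d).
Hypothesis mOm : measurable Om.
Local Notation mu := (lebesgue_rV d).
Local Notation leb := (@lebesgue_measure R).

(** [H] may change sign and [Z] may be infinite, so the comparison is made with the positive part of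
    [H], among nonnegative extended integrals. *)
Lemma le_Rintegral_dominated (H : 'rV[R]_d -> R) (Z : 'rV[R]_d -> \bar R) (c : R) :
  mu.-integrable Om (EFin \o H) -> measurable_fun Om Z -> (forall x, 0 <= Z x)%E ->
  {ae mu, forall x, Om x -> ((H x)%:E <= Z x)%E} ->
  (\int[mu]_(x in Om) Z x <= c%:E)%E -> \int[mu]_(x in Om) H x <= c.
Proof.
move=> iH mZ Z0 HZ Zc.
have mH : measurable_fun Om H by apply/measurable_EFinP; case/integrableP: iH.
pose Hp x := Num.max (H x) 0.
have mHp : measurable_fun Om Hp by apply: measurable_maxr => //; exact: measurable_cst.
have Hp0 x : 0 <= Hp x by rewrite le_max lexx orbT.
have iHp : mu.-integrable Om (EFin \o Hp).
  apply: (@le_integrable _ _ _ mu _ mOm _ (EFin \o H)) => //.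
    exact/measurable_EFinP.
  move=> x _ /=; rewrite lee_fin ger0_norm// ge_max normr_ge0 andbT.
  exact: ler_norm.
apply: (@le_trans _ _ (\int[mu]_(x in Om) Hp x)).
  by apply: le_Rintegral => // x _; rewrite le_max lexx.
rewrite -lee_fin fineK; last exact: integrable_fin_num.
apply: le_trans Zc; apply: ae_ge0_le_integral => //.
- by move=> x _; rewrite lee_fin.
- exact/measurable_EFinP.
apply: filterS HZ => x h Omx; rewrite EFin_max ge_max h//=; exact: Z0.
Qed.

Variables (B : set 'rV[R]_d) (e Z : R).
Hypotheses (mB : measurable B) (BOm : B `<=` Om) (e0 : 0 < e) (e1 : e <= 1) (Z0 : 0 <= Z).

(** One weight controls the three coefficient differences: off [B] they are at most [e], while on
    [B] only the bounds of the class are known, which [Z] covers. Being positive, it can be inverted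
    as a Young parameter. *)
Let theta x : R := e + Z * \1_B x.

Let theta_gt0 x : 0 < theta x.
Proof. by rewrite ltr_pwDl// mulr_ge0// indicE; case: (_ \in _). Qed.

Let mtheta : measurable_fun Om (EFin \o theta).
Proof.
apply/measurable_EFinP; apply: measurable_funD; first exact: measurable_cst.
apply: measurable_funM; first exact: measurable_cst.
by apply: measurable_funTS; exact: measurable_indic.
Qed.

(** The large factor [Z] meets only the integral over [B], which is small for the functions
    concerned. *)
Lemma integral_weight_le (g : 'rV[R]_d -> \bar R) (c1 c2 : R) :
  measurable_fun Om g -> (forall x, 0 <= g x)%E ->
  (\int[mu]_(x in Om) g x <= c1%:E)%E -> (\int[mu]_(x in B) g x <= c2%:E)%E ->
  (\int[mu]_(x in Om) ((theta x)%:E * g x) <= (e * c1 + Z * c2)%:E)%E.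
Proof.
move=> mg g0 h1 h2.
have m1 : measurable_fun Om (EFin \o \1_B : _ -> \bar R).
  by apply/measurable_EFinP; apply: measurable_funTS; exact: measurable_indic.
have i0 x : (0 <= (\1_B x : R)%:E)%E by rewrite lee_fin indicE; case: (_ \in _).
have m2 : measurable_fun Om (fun x => ((\1_B x : R)%:E * g x)%E).
  exact: emeasurable_funM.
have i1 x : (0 <= (\1_B x : R)%:E * g x)%E by rewrite mule_ge0.
rewrite (eq_integral (fun x => (e%:E * g x + Z%:E * ((\1_B x)%:E * g x))%E)); last first.
  move=> x _; rewrite /theta EFinD EFinM ge0_muleDl ?muleA//.
  - by rewrite lee_fin ltW.
  - by rewrite mule_ge0.
rewrite ge0_integralD//; last 4 first.
- by move=> x _; rewrite mule_ge0// lee_fin ltW.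
- exact: measurable_funeM.
- by move=> x _; rewrite mule_ge0.
- exact: measurable_funeM.
have e0' : (0 <= e%:E)%E by rewrite lee_fin ltW.
have Z0' : (0 <= Z%:E)%E by rewrite lee_fin.
rewrite ge0_integralZl// ge0_integralZl// EFinD !EFinM.
apply: leeD; rewrite lee_wpmul2l//; apply: le_trans h2.
rewrite (_ : B = Om `&` B); last by apply/esym/setIidr.
rewrite integral_mkcondr le_eqVlt; apply/orP; left; apply/eqP.
apply: eq_integral => x _; rewrite patchE indicE setIidr//.
by case: (x \in B); rewrite ?mul1e ?mul0e.
Qed.

Variables (a1 b1 a b : 'rV[R]_d -> 'M[R]_k) (q1 q : R -> 'rV[R]_d -> 'M[R]_k).
Variables (G1 G : R -> \bar R) (A Cb C : R).
Hypotheses (k1 : kernel_bound Om q1 G1 C) (k0 : kernel_bound Om q G C).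
Hypothesis ma1 : forall i j, measurable_fun Om (fun x => a1 x i j).
Hypotheses (ac1 : forall x, Om x -> l1norm (a1 x) <= A)
  (ac : forall x, Om x -> l1norm (a x) <= A).
Hypotheses (bc1 : {ae mu, forall x, Om x -> l1norm (b1 x) <= Cb})
  (bc : {ae mu, forall x, Om x -> l1norm (b x) <= Cb}).
Hypothesis Cb0 : 0 <= Cb.
Hypotheses (AZ : (A + A) ^+ 2 <= Z) (CbZ : (Cb + Cb) ^+ 2 <= Z) (CZ : C + C <= Z).

Variables (V : set ('rV[R]_d -> 'cV[R]_k))
  (P : ('rV[R]_d -> 'cV[R]_k) -> 'rV[R]_d -> 'cV[R]_k).
Hypothesis VP : skew_adjoint Om V P.

Variables (u1 u : R -> 'rV[R]_d -> 'cV[R]_k) (du1 du f : 'rV[R]_d -> 'cV[R]_k).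
Variables (t T M M1 S : R).
Hypothesis tT : 0 <= t <= T.
Hypotheses (Vu1 : V (u1 t)) (Vu : V (u t)).
Hypotheses (du1L2 : L2fun Om du1) (duL2 : L2fun Om du).
Hypotheses (u1_bounded : bounded_field Om u1 t M1) (u_bounded : bounded_field Om u t S).
Hypothesis du_bounded : L2dot Om du du <= S.
Hypothesis w_bounded : forall s, 0 <= s <= t ->
  L2dot Om (u1 s \- u s) (u1 s \- u s) <= M.
Hypothesis u_small : forall s, 0 <= s <= t ->
  (\int[mu]_(x in B) (dotv (u s x) (u s x))%:E <= e%:E)%E.
Hypothesis du_small : (\int[mu]_(x in B) (dotv (du x) (du x))%:E <= e%:E)%E.
Hypothesis coef_small : {ae mu, forall x, Om x -> ~ B x ->
  [/\ l1norm (a1 x - a x) <= e, l1norm (b1 x - b x) <= e &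
      (\int[leb]_(s in `[0%R, T]) (l1norm (q1 s x - q s x))%:E <= e%:E)%E]}.
Hypothesis eq1 : {ae mu, forall x, Om x ->
  a1 x *m du1 x + P (u1 t) x + b1 x *m u1 t x + Defs.conv q1 u1 t x = f x}.
Hypothesis eq0 : {ae mu, forall x, Om x ->
  a x *m du x + P (u t) x + b x *m u t x + Defs.conv q u t x = f x}.

Let w s := u1 s \- u s.
Let dw := du1 \- du.
Let r s := q1 s \- q s.

(** Off [B], [c <= e <= 1] gives [c ^+ 2 <= c <= e]; on [B], [c ^+ 2 <= l ^+ 2 <= Z]. *)
Let sqr_weight (c l : R) x : 0 <= c <= l -> l ^+ 2 <= Z -> (~ B x -> c <= e) ->
  c ^+ 2 <= theta x.
Proof.
move=> /andP[c0 cl] lZ small; rewrite /theta indicE.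
have [Bx|nBx] := pselect (B x).
  rewrite mem_set//= mulr1 -[leLHS]add0r; apply: lerD; first exact: ltW.
  by apply: le_trans lZ; rewrite lerXn2r// nnegrE// (le_trans c0).
rewrite memNset//= mulr0 addr0; apply: le_trans (small nBx).
by rewrite expr2 ler_piMl// (le_trans (small nBx)).
Qed.

Lemma diff_equation : {ae mu, forall x, Om x ->
  a1 x *m dw x = - (P (w t) x + b1 x *m w t x + (a1 x - a x) *m du x +
    (b1 x - b x) *m u t x + Defs.conv q1 w t x +
    Defs.conv r u t x)}.
Proof.
near=> x => Omx.
have -> : P (w t) x = P (u1 t) x - P (u t) x.
  by move: Omx; near: x; have [_] := skew_adjointB VP Vu1 Vu.
have cB : Defs.conv q1 u1 t x - Defs.conv q u t x =
    Defs.conv q1 w t x + Defs.conv r u t x.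
  by move: Omx; near: x; exact: (ae_convB mOm k1 k0 u1_bounded u_bounded).
have E1 : a1 x *m du1 x + P (u1 t) x + b1 x *m u1 t x + Defs.conv q1 u1 t x = f x.
  by move: Omx; near: x.
have E0 : a x *m du x + P (u t) x + b x *m u t x + Defs.conv q u t x = f x.
  by move: Omx; near: x.
rewrite /dw /w /= !mulmxBr !mulmxBl; move: E1 E0 cB.
(* With the products replaced by arbitrary vectors the identity is linear and can be checked in each
   entry. *)
move: (a1 x *m du1 x) (a1 x *m du x) (a x *m du x) (P _ x) (P _ x) (b1 x *m u1 t x)
  (b1 x *m u t x) (b x *m u t x) (Defs.conv q1 u1 t x) (Defs.conv q u t x)
  (Defs.conv q1 _ t x) (Defs.conv _ u t x) => y1 y2 y3 y4 y5 y6 y7 y8 y9 y10 y11 y12.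
move=> E1 E0 cB; apply/matrixP => i j.
have h (y z : 'cV[R]_k) : y = z -> y i j = z i j by move=> ->.
by move: (h _ _ E1) (h _ _ E0) (h _ _ cB); rewrite !mxE; lra.
Unshelve. all: by end_near. Qed.

Let Zf x : \bar R :=
  ((theta x)%:E * (dotv (du x) (du x))%:E +
   (theta x)%:E * (dotv (u t x) (u t x))%:E +
   memory_energy q1 w t x +
   (theta x)%:E * memory_energy r u t x)%E.

(** The total coefficient of [dotv (w t x) (w t x)]: [Cb + Cb] from [b1], 1 from each of the three
    coefficient differences, and [C] from the convolution of [q1] with [w]. *)
Let Kq := Cb + Cb + 3 + C.

Let C0 : 0 <= C. Proof. exact: kernel_bound_ge0 k1. Qed.

(** The term with [P (w t) x] stays on the left, since skew-adjointness removes it only after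
    integration over [Om]. *)
Lemma pointwise_rate : {ae mu, forall x, Om x ->
  ((2 * dotv (w t x) (a1 x *m dw x) + 2 * dotv (w t x) (P (w t) x)
    - Kq * dotv (w t x) (w t x))%:E <= Zf x)%E}.
Proof.
have kr : kernel_bound Om r (fun s => G1 s + G s)%E (C + C) := kernel_boundB k1 k0.
have bw : bounded_field Om w t (2 * M1 + 2 * S) := bounded_fieldB mOm u1_bounded u_bounded.
have /andP[t0 tT'] := tT.
near=> x => Omx.
have -> : a1 x *m dw x = - (P (w t) x + b1 x *m w t x + (a1 x - a x) *m du x +
    (b1 x - b x) *m u t x + Defs.conv q1 w t x +
    Defs.conv r u t x).
  by move: Omx; near: x; exact: diff_equation.
have hb1 : l1norm (b1 x) <= Cb by move: Omx; near: x.
have hb : l1norm (b x) <= Cb by move: Omx; near: x.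
have small : ~ B x ->
  [/\ l1norm (a1 x - a x) <= e, l1norm (b1 x - b x) <= e &
      (\int[leb]_(s in `[0%R, T]) (l1norm (q1 s x - q s x))%:E <= e%:E)%E].
  by move: Omx; near: x.
have mass1 : (mass q1 t x <= C%:E)%E.
  by move: Omx; near: x; exact: (ae_mass_le mOm k1).
have massr : (mass r t x <= (C + C)%:E)%E.
  by move: Omx; near: x; exact: (ae_mass_le mOm kr).
have pair1 : forall y e l, 0 < l -> (mass q1 t x <= e%:E)%E ->
    ((2 * `|dotv y (Defs.conv q1 w t x)|)%:E <=
     (e * l * dotv y y)%:E + l^-1%:E * memory_energy q1 w t x)%E.
  by move: Omx; near: x; exact: (ae_conv_pairing mOm k1 bw).
have pairr : forall y e l, 0 < l -> (mass r t x <= e%:E)%E ->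
    ((2 * `|dotv y (Defs.conv r u t x)|)%:E <=
     (e * l * dotv y y)%:E + l^-1%:E * memory_energy r u t x)%E.
  by move: Omx; near: x; exact: (ae_conv_pairing mOm kr u_bounded).
have massth : (mass r t x <= (theta x)%:E)%E.
  rewrite /theta indicE; have [Bx|nBx] := pselect (B x).
    rewrite mem_set//= mulr1; apply: le_trans massr _; rewrite lee_fin.
    by apply: le_trans CZ _; rewrite lerDr ltW.
  rewrite memNset//= mulr0 addr0; have [_ _ ms] := small nBx.
  exact: le_trans (mass_le mOm kr Omx tT') ms.
have ath : l1norm (a1 x - a x) ^+ 2 <= theta x.
  apply: (@sqr_weight _ (A + A)) => // [|/small[]//]; rewrite l1norm_ge0/=.
  apply: le_trans (l1normD _ _) _; rewrite l1normN; apply: lerD; [exact: ac1|exact: ac].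
have bth : l1norm (b1 x - b x) ^+ 2 <= theta x.
  apply: (@sqr_weight _ (Cb + Cb)) => // [|/small[]//]; rewrite l1norm_ge0/=.
  by apply: le_trans (l1normD _ _) _; rewrite l1normN; apply: lerD.
have := pair1 (w t x) _ _ ltr01 mass1; rewrite invr1 mul1e mulr1.
(* The inverse of [theta x] as Young parameter leaves the coefficient 1 on [w] and the weight
   [theta x] on the memory energy of [u]. *)
have thV : 0 < (theta x)^-1 by rewrite invr_gt0.
have := pairr (w t x) _ _ thV massth; rewrite invrK divff ?gt_eqF// mul1r.
have := dotv_mx_le (a1 x - a x) (w t x) (du x).
have := dotv_mx_le (b1 x - b x) (w t x) (u t x).
have := dotv_mx_young (b1 x) (w t x) (w t x) ltr01; rewrite invr1 !mul1r.
have := ler_wpM2r (dotv_ge0 (du x)) ath.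
have := ler_wpM2r (dotv_ge0 (u t x)) bth.
have := ler_wpM2r (addr_ge0 (dotv_ge0 (w t x)) (dotv_ge0 (w t x))) hb1.
rewrite /Zf dotvNr !dotvDr.
move: (memory_energy _ u t x) (memory_energy _ w t x)
  (memory_energy_ge0 r u t x) (memory_energy_ge0 q1 w t x).
have th0 : (0 <= (theta x)%:E)%E by rewrite lee_fin ltW.
have yy0 := dotv_ge0 (w t x).
have n1 := ler_norm (- dotv (w t x) (b1 x *m w t x)).
have n2 := ler_norm (- dotv (w t x) ((a1 x - a x) *m du x)).
have n3 := ler_norm (- dotv (w t x) ((b1 x - b x) *m u t x)).
have n4 := ler_norm (- dotv (w t x) (Defs.conv q1 w t x)).
have n5 := ler_norm (- dotv (w t x) (Defs.conv r u t x)).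
rewrite !normrN in n1 n2 n3 n4 n5.
(* If a memory energy is infinite, so is the right side. *)
move=> [r2| |] [r1| |] //.
- move=> _ _ h1 h2 h3 h4 h5 h6.
  rewrite -!EFinM -!EFinD !lee_fin => h7 h8; rewrite /Kq; lra.
- by move=> *; rewrite addey// addye ?leey// -?EFinM// gt0_muley ?lte_fin.
- move=> *; rewrite gt0_muley ?lte_fin// addey ?leey//.
- move=> *; rewrite gt0_muley ?lte_fin// addey ?leey//.
Unshelve. all: by end_near. Qed.

(** The additional [C * M] is the memory energy of [w]. Each weighted term has total at most [S] and
    share at most [e] on [B], hence [e * (S + Z)], with the factor [C + C] for the memory of [u].
    [M1] is absent from the bound; it ensures finiteness of the convolutions. *)
Lemma energy_rate :
  2 * L2form Om a1 (w t) dw <=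
  (Kq + C) * M + e * (S + Z + (S + Z) + (C + C) * (S + Z)).
Proof.
have /andP[t0 tT'] := tT.
have kr : kernel_bound Om r (fun s => G1 s + G s)%E (C + C) := kernel_boundB k1 k0.
have bw : bounded_field Om w t (2 * M1 + 2 * S) := bounded_fieldB mOm u1_bounded u_bounded.
have t0t : 0 <= t <= t by rewrite t0 lexx.
have [Vw _] := skew_adjointB VP Vu1 Vu.
have [wL2 PwL2] := V_L2 VP Vw.
have dwL2 : L2fun Om dw by exact: L2funB.
have [uL2 _] := V_L2 VP Vu.
have M0 : 0 <= M by apply: le_trans (w_bounded t0t); exact: L2dot_ge0.
have S0 : 0 <= S by apply: le_trans (fld_bound u_bounded t0t); exact: L2dot_ge0.
pose H x := 2 * dotv (w t x) (a1 x *m dw x) + 2 * dotv (w t x) (P (w t) x)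
    - Kq * dotv (w t x) (w t x).
have i1 := integrable_mulr mOm 2 (integrable_dotv_mx mOm ma1 ac1 wL2 dwL2).
have i2 := integrable_mulr mOm 2 (integrable_dotv mOm wL2 PwL2).
have i3 := integrable_mulr mOm Kq (integrable_dotv mOm wL2 wL2).
have i12 := integrable_addr mOm i1 i2.
have iH : mu.-integrable Om (EFin \o H) by apply: (integrableB mOm i12 i3).
have HE : \int[mu]_(x in Om) H x =
    2 * L2form Om a1 (w t) dw - Kq * L2dot Om (w t) (w t).
  rewrite RintegralB// RintegralD// !RintegralZl//.
  - rewrite (_ : \int[mu]_(x in Om) dotv (w t x) (P (w t) x) = 0).
      by rewrite mulr0 addr0.
    rewrite -(skew_adjoint_dot mOm VP Vw).
    by apply: eq_Rintegral => x _; rewrite dotvC.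
  - exact: integrable_dotv.
  - exact: integrable_dotv.
  - exact: integrable_dotv_mx ma1 ac1 _ _.
have mdot (v : 'rV[R]_d -> 'cV[R]_k) : L2fun Om v -> measurable_fun Om (fun x => (dotv (v x) (v x))%:E).
  by move=> [mv _]; apply/measurable_EFinP; exact: measurable_dotv.
have mdu := mdot _ duL2; have mdu' := mdot _ uL2.
have me1 : measurable_fun Om (memory_energy q1 w t).
  by apply: (measurable_memory_energy mOm k1); exact: fld_meas bw.
have mer : measurable_fun Om (memory_energy r u t).
  by apply: (measurable_memory_energy mOm kr); exact: fld_meas u_bounded.
have dot0 (v : 'rV[R]_d -> 'cV[R]_k) x : (0 <= (dotv (v x) (v x))%:E)%E.
  by rewrite lee_fin dotv_ge0.
have th0 x : (0 <= (theta x)%:E)%E by rewrite lee_fin ltW.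
have p1 x : (0 <= (theta x)%:E * (dotv (du x) (du x))%:E)%E by exact: mule_ge0.
have p2 x : (0 <= (theta x)%:E * (dotv (u t x) (u t x))%:E)%E.
  by apply: mule_ge0 => //; exact: (dot0 (u t)).
have p3 x : (0 <= memory_energy q1 w t x)%E by exact: memory_energy_ge0.
have p4 x : (0 <= (theta x)%:E * memory_energy r u t x)%E.
  by apply: mule_ge0 => //; exact: memory_energy_ge0.
have p12 x := adde_ge0 (p1 x) (p2 x).
have p123 x := adde_ge0 (p12 x) (p3 x).
have p1234 x := adde_ge0 (p123 x) (p4 x).
have m1 := emeasurable_funM mtheta mdu.
have m2 := emeasurable_funM mtheta mdu'.
have m4 := emeasurable_funM mtheta mer.
have m12 := emeasurable_funD m1 m2.
have m123 := emeasurable_funD m12 me1.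
have Hle : \int[mu]_(x in Om) H x <=
    M * C + e * (S + Z + (S + Z) + (C + C) * (S + Z)).
  apply: (@le_Rintegral_dominated H Zf _ iH (emeasurable_funD m123 m4) p1234).
    exact: pointwise_rate.
  rewrite (ge0_integralD mu mOm (fun x _ => p123 x) m123 (fun x _ => p4 x) m4).
  rewrite (ge0_integralD mu mOm (fun x _ => p12 x) m12 (fun x _ => p3 x) me1).
  rewrite (ge0_integralD mu mOm (fun x _ => p1 x) m1 (fun x _ => p2 x) m2).
  have I1 := @integral_weight_le _ S e mdu (dot0 du) _ du_small.
  have I2 := @integral_weight_le _ S e mdu' (dot0 (u t)) _ (u_small t0t).
  have I3 : (\int[mu]_(x in Om) memory_energy q1 w t x <= (M * C)%:E)%E.
    apply: (integral_memory_energy_le mOm k1) => //; first exact: fld_meas bw.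
    move=> s st; rewrite (L2dotE mOm (fld_L2 bw s)) lee_fin; exact: w_bounded.
  have J1 : (\int[mu]_(x in Om) memory_energy r u t x <=
      (S * (C + C))%:E)%E.
    apply: (integral_memory_energy_le mOm kr) => //; first exact: fld_meas u_bounded.
    move=> s st; rewrite (L2dotE mOm (fld_L2 u_bounded s)) lee_fin.
    exact: fld_bound u_bounded _ st.
  have J2 : (\int[mu]_(x in B) memory_energy r u t x <=
      (e * (C + C))%:E)%E.
    by apply: (integral_memory_energy_le mOm kr) => //;
      [exact: fld_meas u_bounded|exact: ltW].
  have I4 := @integral_weight_le _ _ _ mer
    (memory_energy_ge0 r u t) J1 J2.
  apply: le_trans (leeD (leeD (leeD (I1 _) (I2 _)) I3) I4) _.
  - by rewrite (L2dotE mOm duL2) lee_fin.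
  - by rewrite (L2dotE mOm uL2) lee_fin; exact: fld_bound u_bounded _ t0t.
  by rewrite -!EFinD lee_fin; nra.
have wM := w_bounded t0t.
have Kq0 : 0 <= Kq by rewrite /Kq; have := C0; move: Cb0; lra.
have := ler_wpM2l Kq0 wM; move: Hle; rewrite HE /w; lra.
Qed.

End energy_rate.

(** * Passage to the limit *)

Lemma L2norm_cvg0B (R : realType) (d k : nat) (Om : set 'rV[R]_d)
    (mOm : measurable Om) (T : Type) (F : set_system T) {FF : Filter F}
    (f g : T -> 'rV[R]_d -> 'cV[R]_k) :
  (forall h, L2fun Om (f h)) -> (forall h, L2fun Om (g h)) ->
  L2norm Om (f h) @[h --> F] --> 0 -> L2norm Om (g h) @[h --> F] --> 0 ->
  L2norm Om (f h \- g h) @[h --> F] --> 0.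
Proof.
move=> fL2 gL2 f0 g0; apply/cvgrPdist_lt => e e0.
have e2 : 0 < e ^+ 2 / 4 by rewrite divr_gt0// exprn_gt0.
apply: filterS2 (L2norm_near0 f0 e2) (L2norm_near0 g0 e2) => h hf hg.
rewrite sub0r normrN ger0_norm ?sqrtr_ge0//.
rewrite -(ltr_pXn2r (_ : 0 < 2)%N) ?nnegrE ?sqrtr_ge0 ?ltW// L2norm_sqr.
have := L2dotD_le mOm (fL2 h) (L2funZ mOm (-1) (gL2 h)).
rewrite (_ : f h \+ _ = f h \- g h); last first.
  by apply/funext => x /=; rewrite scaleN1r.
rewrite (_ : L2dot Om (fun x => -1 *: g h x) _ = L2dot Om (g h) (g h)); first by lra.
by apply: eq_Rintegral => x _; rewrite dotvZl dotvZr mulrA mulrNN !mul1r.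
Qed.

Lemma LinfL2norm_le (R : realType) (d k : nat) (Om : set 'rV[R]_d)
    (T e : R) (u : R -> 'rV[R]_d -> 'cV[R]_k) : 0 <= e ->
  (forall t, 0 <= t <= T -> L2dot Om (u t) (u t) <= e ^+ 2) ->
  (LinfL2norm Om T u <= e%:E)%E.
Proof.
move=> e0 ue; rewrite /LinfL2norm unlock; case: ifPn => _; last by rewrite lee_fin.
apply/ess_supP/aeW => t /=; rewrite lee_fin /patch; case: ifPn => [|_].
  rewrite mem_setE in_itv/= => tT; rewrite ger0_norm ?sqrtr_ge0//.
  by rewrite -(ler_pXn2r (_ : 0 < 2)%N) ?nnegrE ?sqrtr_ge0// L2norm_sqr ue.
by rewrite /= normr0.
Qed.

Lemma cvge0P (R : realType) (f : nat -> \bar R) : (forall m, 0 <= f m)%E ->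
  (forall e : R, 0 < e -> \forall m \near \oo, (f m <= e%:E)%E) ->
  f m @[m --> \oo] --> 0%E.
Proof.
move=> f0 fe; apply/fine_cvgP; split.
  apply: filterS (fe 1 ltr01) => m h.
  by rewrite ge0_fin_numE// (le_lt_trans h)// ltry.
apply/cvgrPdist_le => e e0; apply: filterS (fe e e0) => m h /=.
rewrite sub0r normrN ger0_norm ?fine_ge0//.
by rewrite -lee_fin fineK// ge0_fin_numE// (le_lt_trans h)// ltry.
Qed.

Section bad_sets.
Context {R : realType} {d k : nat} (Om : set 'rV[R]_d).
Hypothesis mOm : measurable Om.
Local Notation mu := (lebesgue_rV d).
Local Notation leb := (@lebesgue_measure R).
Variables (nrm : 'M[R]_k -> R) (K : R).
Hypotheses (nrmP : is_mxnorm nrm) (K0 : 0 < K).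
Hypothesis hK : forall B, l1norm B <= K * nrm B.
Variables (a_ b_ : nat -> 'rV[R]_d -> 'M[R]_k) (a b : 'rV[R]_d -> 'M[R]_k).
Variables (r_ : nat -> R -> 'rV[R]_d -> 'M[R]_k) (G : nat -> R -> \bar R) (C : R).
Hypothesis ma_ : forall m i j, measurable_fun Om (fun x => a_ m x i j).
Hypothesis mb_ : forall m i j, measurable_fun Om (fun x => b_ m x i j).
Hypothesis ma : forall i j, measurable_fun Om (fun x => a x i j).
Hypothesis mb : forall i j, measurable_fun Om (fun x => b x i j).
Hypothesis kr : forall m, kernel_bound Om (r_ m) (G m) C.

Lemma bad_sets (T e : R) : 0 < e ->
  cvg_in_measure_mx Om a_ a -> cvg_in_measure_mx Om b_ b ->
  cvg_in_measure Om
    (fun m x => \int[leb]_(s in `[0, T]) nrm (r_ m s x)) (cst 0) ->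
  exists B : nat -> set 'rV[R]_d, [/\ forall m, measurable (B m),
    forall m, B m `<=` Om, mu (B m) @[m --> \oo] --> 0%E &
    forall m, {ae mu, forall x, Om x -> ~ B m x ->
      [/\ l1norm (a_ m x - a x) <= e, l1norm (b_ m x - b x) <= e &
        (\int[leb]_(s in `[0%R, T]) (l1norm (r_ m s x))%:E <= e%:E)%E]}].
Proof.
move=> e0 ca cb cr.
have [Bq [mBq BqOm Bq0 Bqe]] := memory_cvg_in_measure mOm nrmP K0 hK kr e0 cr.
pose Ba m := Om `&` [set x | e < l1norm (a_ m x - a x)].
pose Bb m := Om `&` [set x | e < l1norm (b_ m x - b x)].
have Ba0 : mu (Ba m) @[m --> \oo] --> 0%E.
  exact: (cvg_in_measure_l1norm mOm ma_ ma ca e0).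
have Bb0 : mu (Bb m) @[m --> \oo] --> 0%E.
  exact: (cvg_in_measure_l1norm mOm mb_ mb cb e0).
have mB (A_ : nat -> 'rV[R]_d -> 'M[R]_k) (A : 'rV[R]_d -> 'M[R]_k) m :
    (forall m i j, measurable_fun Om (fun x => A_ m x i j)) ->
    (forall i j, measurable_fun Om (fun x => A x i j)) ->
    measurable (Om `&` [set x | e < l1norm (A_ m x - A x)]).
  move=> mA_ mA; apply: measurable_lt_set => //; apply: measurable_l1norm => i j.
  by under eq_fun do rewrite !mxE; exact: measurable_funB.
have mBa m : measurable (Ba m) by exact: mB.
have mBb m : measurable (Bb m) by exact: mB.
exists (fun m => Ba m `|` Bb m `|` Bq m); split.
- by move=> m; do 2 apply: measurableU => //.
- by move=> m x [[[]|[]]|/BqOm].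
- have s0 : (mu (Ba m) + mu (Bb m) + mu (Bq m))%E @[m --> \oo] --> 0%E.
    rewrite -[X in _ --> X]adde0 -[X in _ --> (X + _)%E]adde0.
    by apply: cvgeD => //; apply: cvgeD.
  apply: (@squeeze_cvge _ _ _ _ (cst 0%E) _
    (fun m => (mu (Ba m) + mu (Bb m) + mu (Bq m))%E)) => //; last exact: cvg_cst.
  apply: nearW => m; rewrite measure_ge0/=.
  apply: le_trans (measureU2 _ _ _) _ => //; first exact: measurableU.
  by rewrite leeD2r//; exact: measureU2.
move=> m; apply: filterS (Bqe m) => x h Omx nB.
split.
- by rewrite leNgt; apply/negP => lt; apply: nB; left; left.
- by rewrite leNgt; apply/negP => lt; apply: nB; left; right.
- by apply: h => // Bqx; apply: nB; right.
Qed.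

End bad_sets.

Theorem theorem3 (R : realType) (d k : nat) (Om : set 'rV[R]_d)
    (p : 'I_d -> 'M[R]_k) (D V : set ('rV[R]_d -> 'cV[R]_k))
    (P : ('rV[R]_d -> 'cV[R]_k) -> 'rV[R]_d -> 'cV[R]_k)
    (nV : ('rV[R]_d -> 'cV[R]_k) -> R) (nrm : 'M[R]_k -> R)
    (Clo Cup CB CQ : R)
    (a_ b_ : nat -> 'rV[R]_d -> 'M[R]_k) (q_ : nat -> R -> 'rV[R]_d -> 'M[R]_k)
    (a b : 'rV[R]_d -> 'M[R]_k) (q : R -> 'rV[R]_d -> 'M[R]_k)
    (f u : R -> 'rV[R]_d -> 'cV[R]_k) (u_ : nat -> R -> 'rV[R]_d -> 'cV[R]_k) :
  is_domain Om ->
  (forall j, (p j)^T = p j) ->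
  skew_symmetric_on Om p D ->
  skew_adjoint Om V P ->
  extends_p_nabla Om p D V P ->
  is_V_norm Om V P nV ->
  is_mxnorm nrm ->
  0 < Clo -> Clo <= Cup -> 0 <= CB -> 0 <= CQ ->
  (forall m, coefs nrm Om Clo Cup CB CQ (a_ m) (b_ m) (q_ m)) ->
  coefs nrm Om Clo Cup CB CQ a b q ->
  cvg_in_measure_mx Om a_ a ->
  cvg_in_measure_mx Om b_ b ->
  (forall t : R, 0 < t -> cvg_in_measure Om
    (fun m x => \int[lebesgue_measure]_(s in `[0, t]) nrm (q_ m s x - q s x))
    (cst 0)) ->
  H1loc Om f -> causal Om f ->
  (forall m, causal_solution Om V P nV (a_ m) (b_ m) (q_ m) f (u_ m)) ->
  causal_solution Om V P nV a b q f u ->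
  forall T : R, 0 <= T ->
  LinfL2norm Om T (fun t => u_ m t \- u t) @[m --> \oo] --> 0%E.
Proof.
move=> [mOm _ _] _ _ VP _ nVP nrmP Clo0 CloCup CB0 CQ0 cm c0 cva cvb cvq _ _ sm s0 T T0.
have [K K0 hK] := l1_le_mxnorm nrmP.
have [G_ kq_] := choice (fun m => coefs_kernel mOm nrmP K0 hK (cm m)).
have [G kq] := coefs_kernel mOm nrmP K0 hK c0.
have [ju Vu nu cu [du [duL2 duD duC eq0]]] := s0.
have uL2 t : L2fun Om (u t) := (V_L2 VP (Vu t)).1.
have uC : L2continuous Om u := V_norm_L2continuous VP nVP Vu nu.
pose C := K * CQ; have C0 : 0 <= C by rewrite mulr_ge0// ltW.
pose A := (k * k)%:R * Cup; pose Cb := K * CB.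
have Cb0 : 0 <= Cb by rewrite mulr_ge0// ltW.
have [Su hSu] := L2dot_bounded mOm uL2 uC T.
have [Sd hSd] := L2dot_bounded mOm duL2 duC T.
pose S := Num.max Su Sd.
have S0 : 0 <= S.
  by rewrite le_max (le_trans (L2dot_ge0 Om (u 0)))// hSu// lexx.
(* The three summands are the class bounds required of [Z] in [AZ], [CbZ] and [CZ]. *)
pose Z := (A + A) ^+ 2 + (Cb + Cb) ^+ 2 + (C + C).
have [Z1 Z2] : 0 <= (A + A) ^+ 2 /\ 0 <= (Cb + Cb) ^+ 2 by rewrite !sqr_ge0.
have CC0 : 0 <= C + C by rewrite addr_ge0.
have Z0 : 0 <= Z by rewrite !addr_ge0.
pose Kq := Cb + Cb + 3 + C + C.
have Kq0 : 0 <= Kq by rewrite !addr_ge0.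
pose E := S + Z + (S + Z) + (C + C) * (S + Z).
have E0 : 0 <= E by rewrite !addr_ge0// mulr_ge0// addr_ge0.
apply: cvge0P => [m|eps eps0]; first exact: Lnorm_ge0.
(* The bound of [energy_estimate] for [delta = e * E] is at most [e * W]; writing [E + 1] for [E]
   keeps [W] positive. *)
pose W := Clo^-1 * expR (2 * (Kq / Clo + 1) * T) * (E + 1).
have W0 : 0 < W by rewrite !mulr_gt0 ?invr_gt0 ?expR_gt0// ltr_wpDl.
(* [e] is fixed before the index [m], which [W] does not involve. The target is [eps ^+ 2] because
   the energy controls squared norms. *)
pose e := Num.min 1 (eps ^+ 2 / W).
have e0 : 0 < e by rewrite lt_min ltr01 divr_gt0// exprn_gt0.
have e1 : e <= 1 by rewrite ge_min lexx.
have eW : e * W <= eps ^+ 2 by rewrite -ler_pdivlMr// ge_min lexx orbT.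
(* The convergence of the memory terms is assumed at positive times, and [T] may be 0. *)
have T1 : 0 < T + 1 by rewrite ltr_wpDl.
have ma m := (a_Linf (cm m)).1; have mb m := (b_Linf (cm m)).1.
have [B [mB BOm B0 small]] := bad_sets mOm nrmP K0 hK ma mb (a_Linf c0).1 (b_Linf c0).1
  (fun m => kernel_boundB (kq_ m) kq) e0 cva cvb (cvq _ T1).
have usmall := uniform_small_sets mOm mB BOm B0 uL2 uC T e0.
have dusmall := uniform_small_sets mOm mB BOm B0 duL2 duC T e0.
apply: filterS2 usmall dusmall => m us dus.
apply: LinfL2norm_le => [|t1 t1T]; first exact: ltW.
have [jm Vm num cum [dm [dmL2 dmD dmC eqm]]] := sm m.
have umL2 t : L2fun Om (u_ m t) := (V_L2 VP (Vm t)).1.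
have umC : L2continuous Om (u_ m) := V_norm_L2continuous VP nVP Vm num.
(* [Sm] may depend on [m]: it ensures finiteness of the convolutions and does not enter the
   estimate. *)
have [Sm hSm] := L2dot_bounded mOm umL2 umC T.
have wL2 t : L2fun Om (u_ m t \- u t) by exact: L2funB.
have dwL2 t : L2fun Om (dm t \- du t) by exact: L2funB.
have wD : L2derivative Om (fun t => u_ m t \- u t) (fun t => dm t \- du t).
  move=> r; rewrite (_ : (fun h => _) = fun h => L2norm Om
     ((fun x => h^-1 *: (u_ m (r + h) x - u_ m r x) - dm r x) \-
      (fun x => h^-1 *: (u (r + h) x - u r x) - du r x))); last first.
    apply/funext => h; congr (L2norm _ _); apply/funext => x /=.
    rewrite -[LHS]/(_ : 'cV_k) !scalerBr.
    by apply/colP => i; rewrite !mxE; ring.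
  apply: (L2norm_cvg0B mOm _ _ (dmD r) (duD r)).
  - by move=> h; apply: L2funB => //; apply: L2funZ => //; exact: L2funB.
  - by move=> h; apply: L2funB => //; apply: L2funZ => //; exact: L2funB.
have wC : L2continuous Om (fun t => u_ m t \- u t).
  move=> r; rewrite (_ : (fun s => _) = fun s => L2norm Om
     ((u_ m s \- u_ m r) \- (u s \- u r))); last first.
    apply/funext => s; congr (L2norm _ _); apply/funext => x /=.
    by apply/colP => i; rewrite !mxE; ring.
  apply: (L2norm_cvg0B mOm _ _ (umC r) (uC r)).
  - by move=> s; exact: L2funB.
  - by move=> s; exact: L2funB.
have w0 r : r < 0 -> L2dot Om (u_ m r \- u r) (u_ m r \- u r) = 0.
  move=> r0; apply: L2dot_ae0 => //.
  apply: filterS2 (cum _ r0) (cu _ r0) => x h1 h2 Omx /=.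
  by rewrite h1// h2// subrr.
have ac1 := a_l1norm_bound Clo0 (cm m); have ac := a_l1norm_bound Clo0 c0.
have aClo := a_lower_bound (cm m).
have est := energy_estimate mOm (ma m) ac1 (a_symm (cm m)) Clo0 aClo wL2 dwL2 wD wC w0
  (K := Kq) (delta := e * E) Kq0 (mulr_ge0 (ltW e0) E0) T0.
apply: le_trans (est _ t1 t1T) _; last first.
  apply: le_trans eW; rewrite /W [leRHS]mulrCA.
  rewrite ler_pM2l ?mulr_gt0 ?invr_gt0 ?expR_gt0//.
  by rewrite ler_pM2l// lerDl.
move=> r M /andP[r0 rT] wM.
have in0T s : 0 <= s <= r -> 0 <= s <= T.
  by move=> /andP[-> sr]; exact: le_trans sr rT.
have r0r : 0 <= r <= r by rewrite r0 lexx.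
have rT1 : 0 <= r <= T + 1 by rewrite r0 (le_trans rT)// lerDl.
have AZ : (A + A) ^+ 2 <= Z by rewrite /Z -addrA lerDl addr_ge0.
have CbZ : (Cb + Cb) ^+ 2 <= Z by rewrite /Z addrAC lerDr addr_ge0.
have CZ : C + C <= Z by rewrite lerDr addr_ge0.
have um_bounded : bounded_field Om (u_ m) r Sm.
  by split => // s /in0T; exact: hSm.
have u_bounded : bounded_field Om u r S.
  by split => // s /in0T sT; rewrite le_max hSu.
have du_bounded : L2dot Om (du r) (du r) <= S.
  by rewrite le_max hSd ?orbT// in0T.
have wM' s : 0 <= s <= r -> L2dot Om (u_ m s \- u s) (u_ m s \- u s) <= M.
  by move=> /andP[_]; exact: wM.
have us' s : 0 <= s <= r ->
    (\int[lebesgue_rV d]_(x in B m) (dotv (u s x) (u s x))%:E <= e%:E)%E.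
  by move=> /in0T sT; exact/ltW/us.
have dus' : (\int[lebesgue_rV d]_(x in B m) (dotv (du r x) (du r x))%:E <= e%:E)%E.
  by apply/ltW/dus; exact: in0T.
exact: (energy_rate mOm (mB m) (BOm m) e0 e1 Z0 (kq_ m) kq (ma m) ac1 ac
  (ae_b_bound K0 hK (cm m)) (ae_b_bound K0 hK c0) Cb0 AZ CbZ CZ VP rT1
  (Vm r) (Vu r) (dmL2 r) (duL2 r) um_bounded u_bounded du_bounded wM' us' dus'
  (small m) (eqm r) (eq0 r)).
Qed.
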